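(* Assume $\diamondsuit^{\omega_1}(\mathrm{non}(\mathcal M))$. Then for every $\aleph_1$-tree $T$ and every ladder system $\mathbf C$ on $\omega_1$, there is a $2$-colouring of $\mathbf C$ which has no $T$-uniformization.
   Context: A tree is a partial order in which the predecessors of each node are well ordered; $T_\alpha$ is the $\alpha$-th level, and $s\upharpoonright\xi$ is the predecessor of $s$ of height $\xi$. An $\aleph_1$-tree is a tree of height $\omega_1$ with countable levels. A ladder system is $\mathbf C=(C_\alpha)_{\alpha\in\lim(\omega_1)}$ with $C_\alpha$ a cofinal subset of $\alpha$ of order type $\omega$; a $2$-colouring of $\mathbf C$ is $(f_\alpha)$ with $f_\alpha:C_\alpha\to 2$. A subtree of $T$ is a downward closed $S\subseteq T$ in which every node has extensions in $S$ of arbitrarily large countable height. A $T$-uniformization of the colouring is a map $\varphi$ on a subtree $S$ with $\varphi(s\upharpoonright\xi)=f_\alpha(\xi)$ for every $s\in S$ of limit height $\alpha$ and all but finitely many $\xi\in C_\alpha$. $\mathcal M$ is the ideal of meager subsets of $2^\omega$. $\diamondsuit^{\omega_1}(\mathrm{non}(\mathcal M))$ is the statement: whenever $X$ is a set of ordinals of size $\aleph_1$ and $F:\bigcup_{\alpha<\omega_1}\alpha^\alpha\to\mathcal M$ satisfies $F\upharpoonright\alpha^\alpha\in L(\mathbb R)[X]$ for all $\alpha<\omega_1$, there is $g:\omega_1\to 2^\omega$ such that for every $f:\omega_1\to\omega_1$ the set $\{\alpha<\omega_1: f\upharpoonright\alpha\in\alpha^\alpha \text{ and } g(\alpha)\notin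 F(f\upharpoonright\alpha)\}$ is stationary. Here $L(\mathbb R)[X]$ is the least inner model containing $L(\mathbb R)$ and $X$.
   Formalization: Subtrees of T are required to be nonempty; with the empty set allowed as a subtree, the empty map would be a T-uniformization of every colouring and the claim would fail. *)

(* Defs.v *)
From mathcomp Require Import all_boot.
From mathcomp Require Import boolp classical_sets topology cantor.

Set Implicit Arguments.
Unset Strict Implicit.
Unset Printing Implicit Defensive.

Local Open Scope classical_set_scope.

(* The universe of sets: Aczel's well-founded trees, quotiented by
   bisimilarity so that extensional equality is Leibniz equality. *)

Inductive pset : Type := psup (A : Type) of (A -> pset).

Fixpoint peq (x y : pset) : Prop :=
  match x, y with
  | psup A f, psup B g =>
      (forall a, exists b, peq (f a) (g b)) /\
      (forall b, exists a, peq (f a) (g b))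
  end.

Definition pmem (x y : pset) : Prop :=
  match y with psup B g => exists b, peq x (g b) end.

Definition V : Type := {c : pset -> Prop | exists x, c = peq x}.

Definition class_of (x : pset) : V :=
  exist (fun c => exists x, c = peq x) (peq x) (ex_intro _ x erefl).

Definition repr (v : V) : pset := projT1 (cid (proj2_sig v)).

Definition vmem (u v : V) : Prop := pmem (repr u) (repr v).

Notation "x ∈ y" := (vmem x y) (at level 70, no associativity).
Notation "x ∉ y" := (~ vmem x y) (at level 70, no associativity).

Definition vsub (u v : V) : Prop := forall x, x ∈ u -> x ∈ v.
Notation "x ⊆ y" := (vsub x y) (at level 70, no associativity).

Definition vsup (A : Type) (f : A -> V) : V :=
  class_of (psup (fun a => repr (f a))).

Definition idx (v : V) : Type := match repr v with psup A _ => A end.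
Definition elt (v : V) : idx v -> V :=
  match repr v as p return match p with psup A _ => A end -> V with
  | psup A f => fun a => class_of (f a)
  end.

Definition vempty : V := vsup (fun i : False => match i with end).
Definition vupair (x y : V) : V := vsup (fun b : bool => if b then x else y).
Definition vsep (v : V) (P : V -> Prop) : V :=
  vsup (fun i : {i : idx v | P (elt i)} => elt (proj1_sig i)).
Definition vimage (h : V -> V) (v : V) : V := vsup (fun i : idx v => h (elt i)).
Definition vunion (v : V) : V :=
  vsup (fun p : {i : idx v & idx (elt i)} => elt (projT2 p)).
Definition vpower (v : V) : V :=
  vsup (fun P : idx v -> Prop => vsup (fun i : {i | P i} => elt (proj1_sig i))).
Definition vsucc (x : V) : V := vunion (vupair x (vupair x x)).
Definition vpair (x y : V) : V := vupair (vupair x x) (vupair x y).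
Definition vprod (A B : V) : V :=
  vunion (vimage (fun x => vimage (fun y => vpair x y) B) A).

(* Definite description, with the junk value [vempty]. *)
Definition the (P : V -> Prop) : V :=
  if pselect (exists x, P x) is left h then projT1 (cid h) else vempty.

Fixpoint vnat (n : nat) : V := if n is m.+1 then vsucc (vnat m) else vempty.
Definition omega : V := vsup vnat.
Definition two : V := vnat 2.

Lemma peq_refl x : peq x x.
Proof. by elim: x => A f IH /=; split=> a; exists a. Qed.

Lemma peq_sym x y : peq x y -> peq y x.
Proof.
elim: x y => A f IH [B g] /= [h1 h2]; split.
- by move=> b; have [a ab] := h2 b; exists a; apply: IH.
- by move=> a; have [b ab] := h1 a; exists b; apply: IH.
Qed.

Lemma peq_trans x y z : peq x y -> peq y z -> peq x z.
Proof.
elim: x y z => A f IH [B g] [C h] /= [h1 h2] [k1 k2]; split.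
- move=> a; have [b ab] := h1 a; have [c bc] := k1 b.
  by exists c; apply: IH ab bc.
- move=> c; have [b bc] := k2 c; have [a ab] := h2 b.
  by exists a; apply: IH ab bc.
Qed.

Lemma repr_class x : peq x (repr (class_of x)).
Proof.
rewrite /repr; case: cid => y /= e.
by rewrite e; apply: peq_refl.
Qed.

Lemma V_eq (u v : V) : peq (repr u) (repr v) -> u = v.
Proof.
rewrite /repr; case: u v => [c hc] [d hd] /=.
case: cid => x /= ex; case: cid => y /= ey xy; subst c d.
have e : peq x = peq y.
  apply/funext => z; apply/propext; split => h.
  - by apply: peq_trans h; apply: peq_sym.
  - exact: peq_trans h.
case: _ / e in hd *; congr exist; exact: Prop_irrelevance.
Qed.

Lemma class_repr v : class_of (repr v) = v.
Proof. by apply: V_eq; apply: peq_sym; apply: repr_class. Qed.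

Lemma pmem_eq x x' y y' : peq x x' -> peq y y' -> pmem x y -> pmem x' y'.
Proof.
case: y y' => [B g] [C h] xx' /= [h1 h2] [b xb].
have [c bc] := h1 b; exists c.
by apply: peq_trans bc; apply: peq_trans xb; apply: peq_sym.
Qed.

Lemma vext (u v : V) : (forall x, x ∈ u <-> x ∈ v) -> u = v.
Proof.
move=> h; apply: V_eq.
have {}h x : pmem x (repr u) <-> pmem x (repr v).
  have xx := repr_class x; split => m.
  - apply: (pmem_eq (peq_sym xx) (peq_refl _)); apply/h.
    exact: (pmem_eq xx (peq_refl _)).
  - apply: (pmem_eq (peq_sym xx) (peq_refl _)); apply/h.
    exact: (pmem_eq xx (peq_refl _)).
case: (repr u) (repr v) h => [A f] [B g] /= h; split=> [a|b].
- by apply/h; exists a; apply: peq_refl.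
- have /h [a ba] : exists b', peq (g b) (g b') by exists b; apply: peq_refl.
  by exists a; apply: peq_sym.
Qed.

Lemma vsupP A (f : A -> V) x : x ∈ vsup f <-> exists a, x = f a.
Proof.
rewrite /vmem; split.
- move=> m; have := pmem_eq (peq_refl _) (peq_sym (repr_class _)) m.
  by move=> /= [a xa]; exists a; apply: V_eq.
- move=> [a ->]; apply: (pmem_eq (peq_refl _) (repr_class _)) => /=.
  by exists a; apply: peq_refl.
Qed.

Lemma eltP v x : x ∈ v <-> exists i : idx v, x = elt i.
Proof.
rewrite /vmem /elt /idx; case: (repr v) => A f /=; split=> -[a xa]; exists a.
- by apply: V_eq; apply: peq_trans xa _; apply: repr_class.
- by rewrite xa; apply: peq_sym; apply: repr_class.
Qed.

Lemma vmem_ind (P : V -> Prop) :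
  (forall v, (forall x, x ∈ v -> P x) -> P v) -> forall v, P v.
Proof.
move=> IH v; rewrite -(class_repr v); elim: (repr v) => A f IHf.
apply: IH => x; rewrite /vmem => m.
have /= [a xa] := pmem_eq (peq_refl _) (peq_sym (repr_class _)) m.
suff -> : x = class_of (f a) by [].
by apply: V_eq; apply: peq_trans xa _; apply: repr_class.
Qed.

Lemma vemptyP x : x ∉ vempty.
Proof. by move=> /vsupP [[]]. Qed.

Lemma vupairP x y z : z ∈ vupair x y <-> z = x \/ z = y.
Proof.
split=> [/vsupP [[] ->]|[] ->]; [by left|by right| |]; apply/vsupP.
- by exists true.
- by exists false.
Qed.

Lemma vsepP v (P : V -> Prop) x : x ∈ vsep v P <-> x ∈ v /\ P x.
Proof.
split.
- by move=> /vsupP [[i Pi] /= ->]; split=> //; apply/eltP; exists i.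
- move=> [/eltP [i ->] Pi]; apply/vsupP.
  by exists (exist (fun i => P (elt i)) i Pi).
Qed.

Lemma vimageP h v y : y ∈ vimage h v <-> exists x, x ∈ v /\ y = h x.
Proof.
split.
- by move=> /vsupP [i ->]; exists (elt i); split=> //; apply/eltP; exists i.
- by move=> [x [/eltP [i ->] ->]]; apply/vsupP; exists i.
Qed.

Lemma vunionP v x : x ∈ vunion v <-> exists y, y ∈ v /\ x ∈ y.
Proof.
split.
- move=> /vsupP [[i j] /= ->]; exists (elt i).
  by split; apply/eltP; [exists i|exists j].
- move=> [y [/eltP [i ->] /eltP [j ->]]]; apply/vsupP.
  by exists (existT (fun i => idx (elt i)) i j).
Qed.

Lemma vpowerP v x : x ∈ vpower v <-> x ⊆ v.
Proof.
split.
- move=> /vsupP [P ->] y /vsupP [[i Pi] /= ->].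
  by apply/eltP; exists i.
- move=> xv; apply/vsupP; exists (fun i => elt i ∈ x).
  apply: vext => y; split.
  + move=> yx; have /eltP [i ei] := xv _ yx; apply/vsupP.
    have ix : elt i ∈ x by rewrite -ei.
    by exists (exist (fun i => elt i ∈ x) i ix).
  + by move=> /vsupP [[i ix] /= ->].
Qed.

Lemma vprodP A B p :
  p ∈ vprod A B <-> exists x y, [/\ x ∈ A, y ∈ B & p = vpair x y].
Proof.
split.
- move=> /vunionP [_ [/vimageP [x [xA ->]] /vimageP [y [yB ->]]]].
  by exists x, y.
- move=> [x [y [xA yB ->]]]; apply/vunionP.
  by exists (vimage (vpair x) B); split; apply/vimageP; [exists x|exists y].
Qed.

Lemma theP (P : V -> Prop) : (exists x, P x) -> P (the P).
Proof. by rewrite /the => h; case: pselect => // h'; case: cid. Qed.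

(* Functions are sets of ordered pairs; [vfuns A B] is the set $B^A$. *)

Definition function_on (f A : V) : Prop :=
  (forall p, p ∈ f -> exists x y, x ∈ A /\ p = vpair x y) /\
  (forall x, x ∈ A -> exists! y, vpair x y ∈ f).

Definition vfuns (A B : V) : V :=
  vsep (vpower (vprod A B)) (fun f => function_on f A).

Definition app (f x : V) : V := the (fun y => vpair x y ∈ f).

Definition restrict (f A : V) : V :=
  vsep f (fun p => exists x y, x ∈ A /\ p = vpair x y).

Definition injection (f A B : V) : Prop :=
  f ∈ vfuns A B /\
  forall x y, x ∈ A -> y ∈ A -> app f x = app f y -> x = y.

Definition bijection (f A B : V) : Prop :=
  injection f A B /\ forall y, y ∈ B -> exists2 x, x ∈ A & app f x = y.

Definition equinumerous (A B : V) : Prop := exists f, bijection f A B.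
Definition vcountable (A : V) : Prop := exists f, injection f A omega.
Definition vfinite (A : V) : Prop := exists2 n, n ∈ omega & equinumerous A n.

(* [R] is a strict order. *)
Definition well_ordered (A : V) (R : V -> V -> Prop) : Prop :=
  [/\ forall x, x ∈ A -> ~ R x x,
      forall x y z, x ∈ A -> y ∈ A -> z ∈ A -> R x y -> R y z -> R x z
    & forall B, B ⊆ A -> B <> vempty ->
        exists2 m, m ∈ B & forall x, x ∈ B -> x = m \/ R m x].

Definition transitive_set (x : V) : Prop := forall y, y ∈ x -> y ⊆ x.

Definition ordinal (a : V) : Prop := transitive_set a /\ well_ordered a vmem.

Definition order_isomorphic (A : V) (R : V -> V -> Prop)
    (B : V) (S : V -> V -> Prop) : Prop :=
  exists2 h, bijection h A B &
    forall x y, x ∈ A -> y ∈ A -> (R x y <-> S (app h x) (app h y)).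

Definition order_type (A : V) (R : V -> V -> Prop) : V :=
  the (fun a => ordinal a /\ order_isomorphic A R a vmem).

Definition least_uncountable (a : V) : Prop :=
  [/\ ordinal a, ~ vcountable a & forall b, b ∈ a -> vcountable b].

Definition omega1 : V := the least_uncountable.

Definition limit_ordinal (a : V) : Prop :=
  [/\ ordinal a, a <> vempty & forall b, b ∈ a -> vsucc b ∈ a].

Definition Lim1 : V := vsep omega1 limit_ordinal.

Definition unbounded_in (D a : V) : Prop :=
  D ⊆ a /\ forall b, b ∈ a -> exists c, [/\ c ∈ D, c ∈ a & b = c \/ b ∈ c].

Definition club (D : V) : Prop :=
  unbounded_in D omega1 /\
  forall a, a ∈ Lim1 -> unbounded_in (vsep D (fun b => b ∈ a)) a -> a ∈ D.

Definition stationary (S : V) : Prop :=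
  S ⊆ omega1 /\ forall D, club D -> exists2 a, a ∈ D & a ∈ S.

(* The order of the tree on [T] is [R], a set of pairs. *)

Definition tle (R s t : V) : Prop := vpair s t ∈ R.
Definition tlt (R s t : V) : Prop := tle R s t /\ s <> t.

Definition partial_order (T R : V) : Prop :=
  [/\ R ⊆ vprod T T,
      forall s, s ∈ T -> tle R s s,
      forall s t, tle R s t -> tle R t s -> s = t
    & forall s t u, tle R s t -> tle R t u -> tle R s u].

Definition predecessors (T R s : V) : V := vsep T (fun t => tlt R t s).

Definition tree (T R : V) : Prop :=
  partial_order T R /\
  forall s, s ∈ T -> well_ordered (predecessors T R s) (tlt R).

Definition height (T R s : V) : V := order_type (predecessors T R s) (tlt R).

Definition level (T R a : V) : V := vsep T (fun s => height T R s = a).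

Definition tree_of_height (T R a : V) : Prop :=
  [/\ tree T R, ordinal a, level T R a = vempty
    & forall b, b ∈ a -> level T R b <> vempty].

Definition aleph1_tree (T R : V) : Prop :=
  tree_of_height T R omega1 /\
  forall a, a ∈ omega1 -> vcountable (level T R a).

Definition node_restrict (T R s xi : V) : V :=
  the (fun t => t ∈ predecessors T R s /\ height T R t = xi).

(* Nonemptiness is implicit in the notion of a subtree: the empty map would
   otherwise uniformize every colouring. *)
Definition subtree (T R S : V) : Prop :=
  [/\ S ⊆ T, S <> vempty,
      forall s t, s ∈ S -> t ∈ T -> tle R t s -> t ∈ S
    & forall s b, s ∈ S -> b ∈ omega1 ->
        exists t, [/\ t ∈ S, tle R s t
          & b = height T R t \/ b ∈ height T R t]].

Definition ladder_system (C : V) : Prop :=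
  function_on C Lim1 /\
  forall a, a ∈ Lim1 ->
    unbounded_in (app C a) a /\ order_isomorphic omega vmem (app C a) vmem.

Definition two_colouring (C f : V) : Prop :=
  function_on f Lim1 /\ forall a, a ∈ Lim1 -> app f a ∈ vfuns (app C a) two.

Definition uniformization (T R C f phi : V) : Prop :=
  exists S, [/\ subtree T R S, function_on phi S
    & forall s a, s ∈ S -> a ∈ Lim1 -> height T R s = a ->
        vfinite (vsep (app C a) (fun xi =>
          app phi (node_restrict T R s xi) <> app (app f a) xi))].

(* The set $2^\omega$, matched with the library's Cantor space to import its
   topology. *)

Definition reals : V := vfuns omega two.

Definition real_of (r : cantor_space) : V :=
  vsup (fun n => vpair (vnat n) (vnat (r n : bool))).

Definition nowhere_dense (X : topologicalType) (A : set X) : Prop :=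
  interior (closure A) = set0.

Definition meager (X : topologicalType) (A : set X) : Prop :=
  exists2 N : nat -> set X, (forall n, nowhere_dense (N n)) &
    A = \bigcup_n N n.

Definition meager_ideal : V :=
  vsep (vpower reals) (fun A => meager [set r : cantor_space | real_of r ∈ A]).

(* First-order formulas of set theory, de Bruijn style, and satisfaction in
   the structure given by a class and the membership relation. *)

Inductive formula : Type :=
  | FMem of nat & nat
  | FEq of nat & nat
  | FNot of formula
  | FAnd of formula & formula
  | FAll of formula.

Definition env_cons (x : V) (e : nat -> V) (n : nat) : V :=
  if n is m.+1 then e m else x.

Fixpoint sat (M : V -> Prop) (e : nat -> V) (phi : formula) : Prop :=
  match phi with
  | FMem i j => e i ∈ e j
  | FEq i j => e i = e j
  | FNot p => ~ sat M e p
  | FAnd p q => sat M e p /\ sat M e q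
  | FAll p => forall x, M x -> sat M (env_cons x e) p
  end.

Section ZF.
Variable M : V -> Prop.

Definition ax_extensionality : Prop := forall x y, M x -> M y ->
  (forall z, M z -> (z ∈ x <-> z ∈ y)) -> x = y.

Definition ax_foundation : Prop := forall x, M x ->
  (exists2 y, M y & y ∈ x) ->
  exists y, [/\ M y, y ∈ x & ~ exists z, [/\ M z, z ∈ x & z ∈ y]].

Definition ax_pairing : Prop := forall x y, M x -> M y ->
  exists2 p, M p & forall z, M z -> (z ∈ p <-> z = x \/ z = y).

Definition ax_union : Prop := forall x, M x ->
  exists2 u, M u &
    forall z, M z -> (z ∈ u <-> exists y, [/\ M y, y ∈ x & z ∈ y]).

Definition ax_power : Prop := forall x, M x ->
  exists2 p, M p &
    forall z, M z -> (z ∈ p <-> forall w, M w -> w ∈ z -> w ∈ x).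

Definition ax_infinity : Prop := exists i, [/\ M i,
    exists z, [/\ M z, z ∈ i & forall w, M w -> w ∉ z]
  & forall x, M x -> x ∈ i -> exists y, [/\ M y, y ∈ i &
      forall z, M z -> (z ∈ y <-> z ∈ x \/ z = x)]].

Definition ax_separation : Prop :=
  forall (phi : formula) (e : nat -> V), (forall n, M (e n)) ->
  forall a, M a -> exists2 b, M b &
    forall x, M x -> (x ∈ b <-> x ∈ a /\ sat M (env_cons x e) phi).

Definition ax_replacement : Prop :=
  forall (phi : formula) (e : nat -> V), (forall n, M (e n)) ->
  forall a, M a ->
    (forall x, M x -> x ∈ a ->
       exists! y, M y /\ sat M (env_cons x (env_cons y e)) phi) ->
    exists2 b, M b & forall y, M y ->
      (y ∈ b <-> exists x,
         [/\ M x, x ∈ a & sat M (env_cons x (env_cons y e)) phi]).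

Definition models_ZF : Prop :=
  (ax_extensionality /\ ax_foundation /\ ax_pairing /\ ax_union) /\
  (ax_power /\ ax_infinity /\ ax_separation /\ ax_replacement).

Definition inner_model : Prop :=
  [/\ forall x y, M y -> x ∈ y -> M x,
      forall a, ordinal a -> M a
    & models_ZF].
End ZF.

(* The least inner model containing given sets is the intersection of all of
   them. Quantifying over arbitrary classes rather than definable ones does not
   change it, since it is itself a definable inner model. *)
Definition L_reals (x : V) : Prop :=
  forall M : V -> Prop, inner_model M -> (forall r, r ∈ reals -> M r) -> M x.

Definition L_reals_adj (X x : V) : Prop :=
  forall M : V -> Prop, inner_model M ->
    (forall y, L_reals y -> M y) -> M X -> M x.

Definition diamond_non_meager : Prop :=
  forall X : V, (forall a, a ∈ X -> ordinal a) -> equinumerous X omega1 ->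
  forall F : V,
    F ∈ vfuns (vunion (vimage (fun a => vfuns a a) omega1)) meager_ideal ->
    (forall a, a ∈ omega1 -> L_reals_adj X (restrict F (vfuns a a))) ->
  exists2 g, g ∈ vfuns omega1 reals &
    forall f, f ∈ vfuns omega1 omega1 ->
      stationary (vsep omega1 (fun a =>
        restrict f a ∈ vfuns a a /\ app g a ∉ app F (restrict f a))).

(* Main.v *)
From mathcomp Require Import all_boot.
From mathcomp Require Import boolp classical_sets topology cantor.
Require Import Defs.

(** Code the nodes of [T] by countable ordinals so that, for club many [a], the
nodes of height below [a] are coded by ordinals below [a]. A map [phi] on a
subtree then becomes a function [f : omega1 -> omega1]. For [h : a -> a], let
[F h] be the set of the reals [x] which, for some node [s] of height [a], agree
at almost all [k] with the value of [h] at the code of the predecessor of [s]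
whose height is the [k]-th element of [C_a]. As level [a] is countable, so is
[F h]. The diamond sequence [g] for [F] is the colouring: a uniformization
[phi], coded by [f], would give [g a] in [F (f|a)] for every [a] in the club,
witnessed by any node of height [a] in its domain.

The restriction of [F] to [a^a] lies in every inner model [M] containing the
reals, so the set [X] of ordinals plays no role: it is defined from countably
many sequences in the countable ordinal [a], and [M] contains all of these since
it contains a bijection between [a] and a set of natural numbers, recovered from
a real coding the membership relation of [a]. *)

Set Implicit Arguments.
Unset Strict Implicit.
Unset Printing Implicit Defensive.

Local Open Scope classical_set_scope.

(** * Sets, functions and natural numbers *)

Lemma vmem_wf : well_founded vmem.
Proof. by apply: vmem_ind => v IH; constructor. Qed.

Lemma vmem_irr x : x ∉ x.
Proof. by elim/vmem_ind: x => x IH xx; exact: (IH x xx xx). Qed.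

Lemma vmem_asym x y : x ∈ y -> y ∉ x.
Proof.
elim/vmem_ind: x y => x IH y xy yx.
exact: (IH _ yx _ yx xy).
Qed.

Lemma vnonempty x : x <> vempty -> exists y, y ∈ x.
Proof.
move=> xn; apply: contrapT => no; apply: xn; apply: vext => z; split=> zx.
- by case: no; exists z.
- by case: (vemptyP zx).
Qed.

Lemma wf_minimal (r : V -> V -> Prop) (P : V -> Prop) x : well_founded r ->
  P x -> exists2 m, P m & forall y, r y m -> ~ P y.
Proof.
move=> wf; elim: (wf x) => {}x _ IH Px.
have [[y [ryx Py]]|no] := pselect (exists y, r y x /\ P y); first exact: IH Py.
by exists x => // y ryx Py; apply: no; exists y.
Qed.

(** Adapts [Fix] to steps written with total functions: the recursive call is masked by [vempty] off
    the predecessors, which the extensionality hypothesis makes harmless. *)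
Lemma wf_recursion (r : V -> V -> Prop) (G : V -> (V -> V) -> V) :
  well_founded r ->
  (forall x g g', (forall y, r y x -> g y = g' y) -> G x g = G x g') ->
  exists H : V -> V, forall x, H x = G x H.
Proof.
move=> wf Gext.
pose step x (rec : forall y, r y x -> V) :=
  G x (fun y => if pselect (r y x) is left h then rec y h else vempty).
exists (Fix wf (fun=> V) step) => x; rewrite Fix_eq; last first.
  move=> {}x g g' gg'; apply: Gext => y ryx.
  by case: pselect => // h; exact: gg'.
by apply: Gext => y ryx; case: pselect.
Qed.

Lemma vupair_single a b c : vupair a a = vupair b c -> a = b /\ a = c.
Proof.
move=> e; split.
- by have : b ∈ vupair a a by [rewrite e; apply/vupairP; left]; case/vupairP.
- by have : c ∈ vupair a a by [rewrite e; apply/vupairP; right]; case/vupairP.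
Qed.

Lemma vpair_inj a b c d : vpair a b = vpair c d -> a = c /\ b = d.
Proof.
move=> e; have ac : a = c.
  have : vupair a a ∈ vpair c d by rewrite -e; apply/vupairP; left.
  by case/vupairP => /vupair_single[].
split=> //; subst c.
have : vupair a b ∈ vpair a d by rewrite -e; apply/vupairP; right.
have : vupair a d ∈ vpair a b by rewrite e; apply/vupairP; right.
case/vupairP => [/esym/vupair_single[_ <-]|e1].
  by case/vupairP => [/esym/vupair_single[_ <-]|/esym/vupair_single[_ <-]].
have : d ∈ vupair a b by rewrite -e1; apply/vupairP; right.
case/vupairP => // -> ; case/vupairP => [/esym|/esym]/vupair_single[] //.
Qed.

Lemma vsuccP x y : x ∈ vsucc y <-> x ∈ y \/ x = y.
Proof.
split=> [/vunionP [z [/vupairP [->|->]]]|[h|->]].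
- by left.
- by case/vupairP => ->; right.
- by apply/vunionP; exists y; split=> //; apply/vupairP; left.
- apply/vunionP; exists (vupair y y).
  by split; apply/vupairP; [right|left].
Qed.

Lemma vsucc_neq0 x : vsucc x <> vempty.
Proof. by move=> e; apply: (@vemptyP x); rewrite -e; apply/vsuccP; right. Qed.

Lemma vsucc_inj x y : vsucc x = vsucc y -> x = y.
Proof.
move=> e.
have : x ∈ vsucc y by rewrite -e; apply/vsuccP; right.
have : y ∈ vsucc x by rewrite e; apply/vsuccP; right.
by move=> /vsuccP [yx|-> //] /vsuccP [/(vmem_asym yx) //|].
Qed.

Lemma vpair_prodP A B x y : vpair x y ∈ vprod A B <-> x ∈ A /\ y ∈ B.
Proof.
split=> [/vprodP [x' [y' [xA yB /vpair_inj[-> ->]]]] //|[xA yB]].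
by apply/vprodP; exists x, y.
Qed.

Lemma omegaP x : x ∈ omega <-> exists n, x = vnat n.
Proof. exact: vsupP. Qed.

Lemma vnat_omega n : vnat n ∈ omega.
Proof. by apply/omegaP; exists n. Qed.

Lemma vnat_memP n x : x ∈ vnat n <-> exists2 m, m < n & x = vnat m.
Proof.
elim: n x => [|n IH] x /=.
  by split=> [/vemptyP //|[m]].
split=> [/vsuccP [/IH [m mn ->]|->]|[m]].
- by exists m => //; exact: ltnW.
- by exists n.
- rewrite ltnS leq_eqVlt => /orP [/eqP -> ->|mn ->]; apply/vsuccP; first by right.
  by left; apply/IH; exists m.
Qed.

Lemma vnat_inj : injective vnat.
Proof.
elim=> [|m IH] [|n] //= e.
- by case: (@vsucc_neq0 (vnat n)).
- by case: (@vsucc_neq0 (vnat m)).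
- by congr S; apply/IH/vsucc_inj.
Qed.

Lemma twoP x : x ∈ two <-> x = vnat 0 \/ x = vnat 1.
Proof.
split=> [/vnat_memP [[|[|m]] //]|[] ->]; [by left|by right| |].
- by apply/vnat_memP; exists 0.
- by apply/vnat_memP; exists 1.
Qed.

Lemma vfunsP A B f : f ∈ vfuns A B <->
  [/\ forall p, p ∈ f -> exists x y, [/\ x ∈ A, y ∈ B & p = vpair x y]
    & forall x, x ∈ A -> exists! y, vpair x y ∈ f].
Proof.
split=> [/vsepP [/vpowerP fAB [_ fu]]|[fp fu]].
  by split=> // p /fAB /vprodP.
apply/vsepP; split; first by apply/vpowerP => p /fp /vprodP.
by split=> // p /fp [x [y [xA _ ->]]]; exists x, y.
Qed.

Lemma app_eq f x y' : (exists! y, vpair x y ∈ f) -> vpair x y' ∈ f ->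
  app f x = y'.
Proof.
move=> [y0 [xy0 u]] xy'.
have e : vpair x (app f x) ∈ f.
  by apply: (@theP (fun y => vpair x y ∈ f)); exists y0.
by rewrite -(u _ e); exact: u.
Qed.

Lemma app_mem f x : (exists! y, vpair x y ∈ f) -> vpair x (app f x) ∈ f.
Proof. by move=> [y [xy _]]; apply: (@theP (fun y => vpair x y ∈ f)); exists y. Qed.

Lemma app_vfuns A B f x : f ∈ vfuns A B -> x ∈ A ->
  vpair x (app f x) ∈ f /\ app f x ∈ B.
Proof.
move=> /vfunsP [fp fu] xA; have m := app_mem (fu _ xA).
by split=> //; have [x' [y' [_ yB /vpair_inj[_ ->]]]] := fp _ m.
Qed.

Lemma app_vfuns_eq A B f x y : f ∈ vfuns A B -> vpair x y ∈ f -> app f x = y.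
Proof.
move=> /vfunsP [fp fu] xy; apply: app_eq => //.
by have [x' [y' [xA _ /vpair_inj[-> _]]]] := fp _ xy; exact: fu.
Qed.

Lemma vfuns_domain_inj A A' B B' f : f ∈ vfuns A B -> f ∈ vfuns A' B' -> A = A'.
Proof.
move=> /vfunsP [fp fu] /vfunsP [fp' fu']; apply: vext => x; split=> xA.
- have [y [xy _]] := fu _ xA.
  by have [x' [y' [xA' _ /vpair_inj[-> _]]]] := fp' _ xy.
- have [y [xy _]] := fu' _ xA.
  by have [x' [y' [xA' _ /vpair_inj[-> _]]]] := fp _ xy.
Qed.

Definition vgraph (h : V -> V) (A : V) : V := vimage (fun x => vpair x (h x)) A.

Lemma vgraph_memP h A p :
  p ∈ vgraph h A <-> exists x, x ∈ A /\ p = vpair x (h x).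
Proof. exact: vimageP. Qed.

Lemma vgraphP h A x y : vpair x y ∈ vgraph h A <-> x ∈ A /\ y = h x.
Proof.
split=> [/vgraph_memP [z [zA /vpair_inj[-> ->]]] //|[xA ->]].
by apply/vgraph_memP; exists x.
Qed.

Lemma vgraph_function h A : function_on (vgraph h A) A.
Proof.
split=> [p /vgraph_memP [x [xA ->]]|x xA]; first by exists x, (h x).
by exists (h x); split=> [|y]; [apply/vgraphP | move=> /vgraphP []].
Qed.

Lemma app_vgraph h A x : x ∈ A -> app (vgraph h A) x = h x.
Proof.
move=> xA; have [_ u] := vgraph_function h A.
by apply: (app_eq (u _ xA)); apply/vgraphP.
Qed.

Lemma vgraph_vfuns h A B : (forall x, x ∈ A -> h x ∈ B) -> vgraph h A ∈ vfuns A B.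
Proof.
move=> hAB; have [_ u] := vgraph_function h A; apply/vfunsP; split=> // p.
by move=> /vgraph_memP [x [xA ->]]; exists x, (h x); split=> //; exact: hAB.
Qed.

Lemma restrict_vgraph h A A' : A' ⊆ A -> restrict (vgraph h A) A' = vgraph h A'.
Proof.
move=> A'A; apply: vext => p; split.
- move=> /vsepP [/vgraph_memP [x [xA ->]] [x' [y' [xA' /vpair_inj[e _]]]]].
  by apply/vgraphP; rewrite e.
- move=> /vgraph_memP [x [xA ->]]; apply/vsepP; split; last by exists x, (h x).
  by apply/vgraphP; split=> //; exact: A'A.
Qed.

(** * Countable sets and ordinals *)

Lemma vcountableP A : vcountable A <->
  exists i : V -> nat, forall x y, x ∈ A -> y ∈ A -> i x = i y -> x = y.
Proof.
split=> [[f [fA finj]]|[i iinj]].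
- have /choice [i iP] : forall x, exists n, x ∈ A -> app f x = vnat n.
    move=> x; have [xA|] := pselect (x ∈ A); last by exists 0.
    by have [_ /omegaP [n e]] := app_vfuns fA xA; exists n.
  by exists i => x y xA yA e; apply: finj => //; rewrite !iP // e.
- exists (vgraph (fun x => vnat (i x)) A); split.
    by apply: vgraph_vfuns => x _; exact: vnat_omega.
  move=> x y xA yA; rewrite !app_vgraph // => /vnat_inj; exact: iinj.
Qed.

Lemma vcountable_sub A B : A ⊆ B -> vcountable B -> vcountable A.
Proof.
move=> AB /vcountableP [i iP]; apply/vcountableP; exists i => x y xA yA.
by apply: iP; exact: AB.
Qed.

Lemma vcountable_range A : (exists d : nat -> V, forall x, x ∈ A -> exists n, x = d n) ->
  vcountable A.
Proof.
move=> [d dP]; apply/vcountableP.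
have /choice [i iP] : forall x, exists n, x ∈ A -> x = d n.
  move=> x; have [/dP [n e]|] := pselect (x ∈ A); last by exists 0.
  by exists n.
by exists i => x y xA yA e; rewrite (iP x) // (iP y) // e.
Qed.

Lemma vcountable_union A : vcountable A -> (forall x, x ∈ A -> vcountable x) ->
  vcountable (vunion A).
Proof.
move=> /vcountableP [i iP] cA.
have /choice [k kP] : forall x, exists k : V -> nat, x ∈ A ->
    forall y z, y ∈ x -> z ∈ x -> k y = k z -> y = z.
  move=> x; have [/cA /vcountableP [k kP]|] := pselect (x ∈ A).
    by exists k.
  by exists (fun=> 0).
have /choice [b bP] : forall y, exists x, y ∈ vunion A -> x ∈ A /\ y ∈ x.
  move=> y; have [/vunionP [x h]|] := pselect (y ∈ vunion A); last by exists vempty.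
  by exists x.
apply/vcountableP; exists (fun y => pickle (i (b y), k (b y) y)) => y z yA zA.
have [byA yb] := bP _ yA; have [bzA zb] := bP _ zA.
move=> /(pcan_inj (@pickleK _)) [e1 e2].
have eb := iP _ _ byA bzA e1.
by apply: (kP (b y) byA) => //; [rewrite eb|rewrite e2 eb].
Qed.

Lemma vcountable_image h A : vcountable A -> vcountable (vimage h A).
Proof.
move=> /vcountableP [i iP].
have /choice [b bP] : forall y, exists x, y ∈ vimage h A -> x ∈ A /\ y = h x.
  move=> y; have [/vimageP [x e]|] := pselect (y ∈ vimage h A); last by exists vempty.
  by exists x.
apply/vcountableP; exists (i \o b) => y z /bP [byA ey] /bP [bzA ez] /= e.
by rewrite ey ez; congr h; exact: iP.
Qed.

Lemma vcountable_vsup (d : nat -> V) : vcountable (vsup d).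
Proof. by apply: vcountable_range; exists d => x /vsupP. Qed.

Lemma vcountable_vsucc x : vcountable x -> vcountable (vsucc x).
Proof.
move=> cx; apply: vcountable_union => [|y].
  apply: vcountable_range; exists (fun n => if n is 0 then x else vupair x x) => y.
  by case/vupairP => ->; [exists 0|exists 1].
case/vupairP => -> //; apply: vcountable_range; exists (fun=> x) => z.
by case/vupairP => ->; exists 0.
Qed.

Lemma ordinal_trans a x y : ordinal a -> y ∈ a -> x ∈ y -> x ∈ a.
Proof. by move=> [t _] ya xy; exact: t ya _ xy. Qed.

(** Since membership is well founded, these are exactly the ordinals ([ordinalP]), and no well order
    has to be carried along. *)
Definition hereditary a := transitive_set a /\ forall x, x ∈ a -> transitive_set x.

Lemma hereditary_mem a x : hereditary a -> x ∈ a -> hereditary x.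
Proof. by move=> [ta h] xa; split; [exact: h|move=> y yx; apply/h/(ta _ xa)]. Qed.

(** Double induction: if neither set belongs to the other, comparing the members of each with the
    other set puts them all inside it. *)
Lemma hereditary_trichotomy a b : hereditary a -> hereditary b ->
  [\/ a ∈ b, a = b | b ∈ a].
Proof.
elim/vmem_ind: a b => a IHa; elim/vmem_ind => b IHb ha hb.
have [ba|ba] := pselect (b ∈ a); first exact: Or33.
have [ab|ab] := pselect (a ∈ b); first exact: Or31.
apply: Or32; apply: vext => x; split=> [xa|xb].
- have [//|e|bx] := IHa _ xa b (hereditary_mem ha xa) hb.
    by case: ba; rewrite -e.
  by case: ba; exact: ha.1 bx.
- have [ax|e|//] := IHb _ xb ha (hereditary_mem hb xb).
    by case: ab; exact: hb.1 ax.
  by case: ab; rewrite e.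
Qed.

Lemma ordinalP a : ordinal a <-> hereditary a.
Proof.
split=> [[ta [_ tr _]]|ha].
  split=> // x xa y yx z zy.
  have ya := ta _ xa _ yx; have za := ta _ ya _ zy.
  exact: tr zy yx.
split; first exact: ha.1.
split=> [x _|x y z _ _ za xy yz|B Ba /vnonempty [b bB]].
- exact: vmem_irr.
- exact: ha.2 yz _ xy.
- have [m mB mmin] := @wf_minimal _ (fun x => x ∈ B) _ vmem_wf bB.
  exists m => // x xB.
  have [xm|->|mx] := hereditary_trichotomy (hereditary_mem ha (Ba _ xB))
    (hereditary_mem ha (Ba _ mB)).
  + by case: (mmin _ xm).
  + by left.
  + by right.
Qed.

Lemma ordinal_mem a x : ordinal a -> x ∈ a -> ordinal x.
Proof. by move=> /ordinalP ha xa; apply/ordinalP; exact: (hereditary_mem ha). Qed.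

Lemma ordinal_trichotomy a b : ordinal a -> ordinal b ->
  [\/ a ∈ b, a = b | b ∈ a].
Proof. by move=> /ordinalP ha /ordinalP hb; exact: hereditary_trichotomy. Qed.

Lemma ordinal_sub a b : ordinal a -> ordinal b -> a ⊆ b -> a = b \/ a ∈ b.
Proof.
move=> oa ob ab; have [|->|/ab/vmem_irr//] := ordinal_trichotomy oa ob.
- by right.
- by left.
Qed.

Lemma ordinal_of_transitive a : transitive_set a ->
  (forall x, x ∈ a -> ordinal x) -> ordinal a.
Proof. by move=> ta oa; apply/ordinalP; split=> // x /oa /ordinalP []. Qed.

Lemma ordinal_vsucc a : ordinal a -> ordinal (vsucc a).
Proof.
move=> oa; apply: ordinal_of_transitive => [x|x] /vsuccP [xa|->] //.
- by move=> y yx; apply/vsuccP; left; exact: ordinal_trans yx.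
- by move=> y yx; apply/vsuccP; left.
- exact: ordinal_mem xa.
Qed.

Lemma ordinal_vunion A : (forall x, x ∈ A -> ordinal x) -> ordinal (vunion A).
Proof.
move=> oA; apply: ordinal_of_transitive => [x|x] /vunionP [y [yA xy]].
- move=> z zx; apply/vunionP; exists y; split=> //.
  by apply: ordinal_trans zx => //; exact: oA.
- by apply: ordinal_mem xy; exact: oA.
Qed.

Lemma ordinal_vnat n : ordinal (vnat n).
Proof.
elim: n => [|n IH] /=; last exact: ordinal_vsucc.
by apply: ordinal_of_transitive => x /vemptyP.
Qed.

Lemma ordinal_omega : ordinal omega.
Proof.
apply: ordinal_of_transitive => x /omegaP [n ->]; last exact: ordinal_vnat.
by move=> y /vnat_memP [m _ ->]; exact: vnat_omega.
Qed.

(** [omega1] is a definite description; that it meets its description stays a hypothesis here and is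
    settled by a case distinction in the theorem. *)
Lemma omega1_intro : least_uncountable omega1 ->
  forall a, ordinal a -> vcountable a -> a ∈ omega1.
Proof.
move=> [o1 nc _] a oa ca.
have [//|e|h] := ordinal_trichotomy oa o1; first by case: nc; rewrite -e.
by case: nc; apply: vcountable_sub ca => x; exact: ordinal_trans.
Qed.

Lemma omega1_vunion : least_uncountable omega1 ->
  forall A, vcountable A -> A ⊆ omega1 -> vunion A ∈ omega1.
Proof.
move=> lu A cA Aw; have [o1 _ c1] := lu; apply: omega1_intro => //.
- by apply: ordinal_vunion => x /Aw; exact: ordinal_mem.
- by apply: vcountable_union => // x /Aw; exact: c1.
Qed.

Lemma omega1_vsucc : least_uncountable omega1 ->
  forall a, a ∈ omega1 -> vsucc a ∈ omega1.
Proof.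
move=> lu a aw; have [o1 _ c1] := lu; apply: omega1_intro => //.
- by apply: ordinal_vsucc; exact: ordinal_mem aw.
- by apply: vcountable_vsucc; exact: c1.
Qed.

(** * Inner models containing all reals *)

(** One step along the antidiagonals of the plane. Pairs are enumerated by plain iteration so that a
    first-order formula can describe the graph by local conditions. *)
Definition diag_next (p : nat * nat) : nat * nat :=
  if p.2 is m.+1 then (p.1.+1, m) else (0, p.1.+1).

Definition diag (t : nat) : nat * nat := iter t diag_next (0, 0).

Lemma diag_surj n m : exists t, diag t = (n, m).
Proof.
have [k] := ubnP (n + m); elim: k n m => // k IHk.
elim=> [[|m]|n IHn m] h; first by exists 0.
- have [|t e] := IHk m 0; first by rewrite addn0.
  by exists t.+1; rewrite /diag iterS -/(diag t) e.
- have [|t e] := IHn m.+1; first by rewrite addnS.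
  by exists t.+1; rewrite /diag iterS -/(diag t) e.
Qed.

Definition vdiag (t : nat) : V := vpair (vnat (diag t).1) (vnat (diag t).2).

Section InnerModel.
Variable M : V -> Prop.
Hypothesis Minner : inner_model M.

(** Definability over [M] is kept semantic, up to equivalence on environments from [M], so that
    formulas are found through closure lemmas instead of being written out. *)
Definition definable (P : (nat -> V) -> Prop) : Prop :=
  exists phi, forall e, (forall n, M (e n)) -> (sat M e phi <-> P e).

Lemma definable_ext P Q : definable P ->
  (forall e, (forall n, M (e n)) -> (P e <-> Q e)) -> definable Q.
Proof. by move=> [phi h] PQ; exists phi => e Me; rewrite h // PQ. Qed.

Lemma definable_mem i j : definable (fun e => e i ∈ e j).
Proof. by exists (FMem i j). Qed.

Lemma definable_eq i j : definable (fun e => e i = e j).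
Proof. by exists (FEq i j). Qed.

Lemma definable_not P : definable P -> definable (fun e => ~ P e).
Proof. by move=> [phi h]; exists (FNot phi) => e Me /=; rewrite h. Qed.

Lemma definable_and P Q : definable P -> definable Q ->
  definable (fun e => P e /\ Q e).
Proof.
by move=> [phi h] [psi k]; exists (FAnd phi psi) => e Me /=; rewrite h // k.
Qed.

Lemma definable_or P Q : definable P -> definable Q ->
  definable (fun e => P e \/ Q e).
Proof.
move=> dP dQ.
apply: (definable_ext (definable_not (definable_and (definable_not dP)
  (definable_not dQ)))) => e _.
by split=> [h|[] h []//]; apply: contrapT => /not_orP.
Qed.

Lemma definable_imp P Q : definable P -> definable Q ->
  definable (fun e => P e -> Q e).
Proof.
move=> dP dQ; apply: (definable_ext (definable_or (definable_not dP) dQ)) => e _.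
split=> [[h /h|]//|h]; have [/h|] := pselect (P e); [by right|by left].
Qed.

Lemma definable_iff P Q : definable P -> definable Q ->
  definable (fun e => P e <-> Q e).
Proof. by move=> dP dQ; apply: definable_and; apply: definable_imp. Qed.

Lemma definable_all (Q : V -> (nat -> V) -> Prop) :
  definable (fun e => Q (e 0) (fun n => e n.+1)) ->
  definable (fun e => forall x, M x -> Q x e).
Proof.
move=> [phi h]; exists (FAll phi) => e Me /=; split=> k x Mx.
- by have /h := k x Mx; apply; case.
- by apply/h; [case|exact: k].
Qed.

Lemma definable_ex (Q : V -> (nat -> V) -> Prop) :
  definable (fun e => Q (e 0) (fun n => e n.+1)) ->
  definable (fun e => exists x, M x /\ Q x e).
Proof.
move=> dQ; have dn := definable_not (definable_all (Q := fun x e => ~ Q x e)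
  (definable_not dQ)).
apply: (definable_ext dn) => e _; split=> [h|[x [Mx Qx]] h]; last exact: h Qx.
by apply: contrapT => no; apply: h => x Mx Qx; apply: no; exists x.
Qed.

Ltac definability_with tac := repeat (cbv beta; first
  [ tac
  | apply: definable_mem | apply: definable_eq
  | apply: definable_all | apply: definable_ex
  | apply: definable_iff | apply: definable_and | apply: definable_or
  | apply: definable_not | apply: definable_imp ]).

(** * Closure of the model under basic set operations *)

Lemma M_trans x y : M y -> x ∈ y -> M x.
Proof. by case: Minner => h _ _; apply: h. Qed.

Lemma M_ordinal a : ordinal a -> M a.
Proof. by case: Minner => _ h _; apply: h. Qed.

Lemma M_vempty : M vempty.
Proof. exact: M_ordinal (ordinal_vnat 0). Qed.

Lemma M_vnat n : M (vnat n).
Proof. exact: M_ordinal (ordinal_vnat n). Qed.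

Lemma M_omega : M omega.
Proof. exact: M_ordinal ordinal_omega. Qed.

(** The axiom specifies its witness only for members in [M]; transitivity of [M] makes it the true
    pair. *)
Lemma M_vupair x y : M x -> M y -> M (vupair x y).
Proof.
move=> Mx My; have [_ _ [[_ [_ [pair _]]] _]] := Minner.
have [p Mp pP] := pair _ _ Mx My.
rewrite (_ : vupair x y = p) //; apply: vext => z; split.
- by move=> /vupairP h; apply/pP => //; case: h => ->.
- by move=> zp; apply/vupairP/pP => //; exact: M_trans zp.
Qed.

Lemma M_vpair x y : M x -> M y -> M (vpair x y).
Proof. by move=> Mx My; do ?apply: M_vupair. Qed.

Lemma M_vpair_inv x y : M (vpair x y) -> M x /\ M y.
Proof.
move=> Mp; have Mu : M (vupair x y) by apply: (M_trans Mp); apply/vupairP; right.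
by split; apply: (M_trans Mu); apply/vupairP; [left|right].
Qed.

Lemma M_vunion x : M x -> M (vunion x).
Proof.
move=> Mx; have [_ _ [[_ [_ [_ union]]] _]] := Minner.
have [u Mu uP] := union _ Mx.
rewrite (_ : vunion x = u) //; apply: vext => z; split.
- move=> /vunionP [y [yx zy]]; have My := M_trans Mx yx.
  by apply/uP; [exact: M_trans zy|exists y].
- move=> zu; have /uP : M z by exact: M_trans zu.
  by move=> [h _]; have [y [_ yx zy]] := h zu; apply/vunionP; exists y.
Qed.

Lemma M_vsucc x : M x -> M (vsucc x).
Proof. by move=> Mx; apply: M_vunion; do ?apply: M_vupair. Qed.

Lemma M_power x : M x -> exists2 p, M p & forall z, z ∈ p <-> M z /\ z ⊆ x.
Proof.
move=> Mx; have [_ _ [_ [power _]]] := Minner.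
have [p Mp pP] := power _ Mx; exists p => // z; split=> [zp|[Mz zx]].
- have Mz := M_trans Mp zp; split=> // w wz.
  by apply: (iffLR (pP z Mz) zp) => //; exact: M_trans wz.
- by apply/pP => // w _; exact: zx.
Qed.

Fixpoint all_M (ps : seq V) : Prop := if ps is p :: s then M p /\ all_M s else True.

(** The member under test has index 0 and the parameters [ps] follow from index 1; beyond them [nth]
    gives [vempty], which is in [M]. *)
Lemma M_separation P ps a A : definable P -> M a -> all_M ps ->
  (forall x, x ∈ A <-> x ∈ a /\ P (env_cons x (nth vempty ps))) -> M A.
Proof.
move=> [phi h] Ma Mps AP; have [_ _ [_ [_ [_ [sep _]]]]] := Minner.
have Me n : M (nth vempty ps n).
  elim: ps n Mps {AP} => [|p ps IH] n /=; first by rewrite nth_nil => _; exact: M_vempty.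
  by case: n => [[]//|n [_]]; exact: IH.
have [b Mb bP] := sep phi (nth vempty ps) Me a Ma.
have sP x : M x -> (sat M (env_cons x (nth vempty ps)) phi <->
    P (env_cons x (nth vempty ps))) by move=> Mx; apply: h; case.
rewrite (_ : A = b) //; apply: vext => x; split.
- by move=> /AP [xa Px]; have Mx := M_trans Ma xa; apply/bP => //; rewrite sP.
- move=> xb; have Mx := M_trans Mb xb; apply/AP.
  by have [] := iffLR (bP _ Mx) xb; rewrite sP.
Qed.

(** Absoluteness: the quantifier of the formula ranges over [M] only, but members of sets in [M] lie
    in [M]. *)
Lemma definable_vupair i j k : definable (fun e => e i = vupair (e j) (e k)).
Proof.
apply: (@definable_ext (fun e =>
  forall w, M w -> (w ∈ e i <-> w = e j \/ w = e k))).
  by definability_with fail.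
move=> e Me; split=> [h|-> w _]; last exact: vupairP.
apply: vext => w; split=> [wi|wj].
- by apply/vupairP/h => //; exact: M_trans wi.
- by apply/h; [case/vupairP: wj => ->|exact/vupairP].
Qed.

Lemma definable_vpair i j k : definable (fun e => e i = vpair (e j) (e k)).
Proof.
apply: (@definable_ext (fun e => forall w, M w ->
    (w ∈ e i <-> w = vupair (e j) (e j) \/ w = vupair (e j) (e k)))).
  by definability_with ltac:(apply: definable_vupair).
move=> e Me; split=> [h|-> w _]; last exact: vupairP.
apply: vext => w; split=> [wi|wj].
- by apply/vupairP/h => //; exact: M_trans wi.
- by apply/h; [case/vupairP: wj => ->; exact: M_vupair|exact/vupairP].
Qed.

Lemma definable_vpair_mem i j k : definable (fun e => vpair (e i) (e j) ∈ e k).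
Proof.
apply: (@definable_ext (fun e => exists p, M p /\
    (p = vpair (e i) (e j) /\ p ∈ e k))).
  by definability_with ltac:(apply: definable_vpair).
move=> e Me; split=> [[p [_ [-> //]]]|h].
by exists (vpair (e i) (e j)); split=> //; exact: M_trans h.
Qed.

Lemma definable_vsucc i j : definable (fun e => e i = vsucc (e j)).
Proof.
apply: (@definable_ext (fun e =>
  forall w, M w -> (w ∈ e i <-> w ∈ e j \/ w = e j))).
  by definability_with fail.
move=> e Me; split=> [h|-> w _]; last exact: vsuccP.
apply: vext => w; split=> [wi|wj].
- by apply/vsuccP/h => //; exact: M_trans wi.
- by apply/h; [exact: M_trans (M_vsucc (Me j)) wj|exact/vsuccP].
Qed.

Ltac definability := definability_with ltac:(first
  [apply: definable_vpair | apply: definable_vpair_mem | apply: definable_vsucc]).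

(** Kuratowski pairs live in the double power set of the union of [A] and [B], here formed inside
    [M], from which the product is separated. *)
Lemma M_vprod A B : M A -> M B -> M (vprod A B).
Proof.
move=> MA MB; have MU : M (vunion (vupair A B)) by apply/M_vunion/M_vupair.
have [p Mp pP] := M_power MU; have [q Mq qP] := M_power Mp.
apply: (@M_separation (fun e => exists x, M x /\ (x ∈ e 1 /\
  exists y, M y /\ (y ∈ e 2 /\ e 0 = vpair x y))) [:: A; B] q) => //=.
  by definability.
move=> z; split=> [/vprodP [x [y [xA yB ->]]]|].
  have [Mx My] := (M_trans MA xA, M_trans MB yB).
  split; last by exists x; split=> //; split=> //; exists y.
  have xU : x ∈ vunion (vupair A B).
    by apply/vunionP; exists A; split=> //; apply/vupairP; left.
  have yU : y ∈ vunion (vupair A B).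
    by apply/vunionP; exists B; split=> //; apply/vupairP; right.
  apply/qP; split; first exact: M_vpair.
  move=> w wz; apply/pP; case/vupairP: wz => ->.
  - by split; [exact: M_vupair|move=> v /vupairP [] ->].
  - by split; [exact: M_vupair|move=> v /vupairP [] ->].
by move=> [_ [x [_ [xA [y [_ [yB ->]]]]]]]; apply/vpair_prodP.
Qed.

(** * Sets that the model contains because it contains all reals *)

Hypothesis Mreals : forall r, r ∈ reals -> M r.

(** The indicator function of [A] is a real, and [A] is where it takes the value 1. *)
Lemma M_sub_omega A : A ⊆ omega -> M A.
Proof.
move=> Aw.
pose chi n := if pselect (n ∈ A) then vnat 1 else vnat 0.
have Mr : M (vgraph chi omega).
  apply/Mreals/vgraph_vfuns => n _; rewrite /chi; apply/twoP.
  by case: pselect; [right|left].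
apply: (@M_separation (fun e => vpair (e 0) (e 1) ∈ e 2)
  [:: vnat 1; vgraph chi omega] omega) => //=.
- by definability.
- exact: M_omega.
- by split; [exact: (M_vnat 1)|].
- move=> x; split=> [xA|[_ /vgraphP [_]]].
    split; first exact: Aw.
    by apply/vgraphP; split; [exact: Aw|rewrite /chi; case: pselect].
  by rewrite /chi; case: pselect => // _ /vsucc_neq0.
Qed.

(** Countability witnessed inside [M]: [K] may give an element several indices, but never one index
    to two elements of [B]. *)
Definition M_countable (B : V) : Prop :=
  M B /\ exists K, [/\ M K,
    forall x, x ∈ B -> exists2 t, t ∈ omega & vpair t x ∈ K
  & forall t x y, x ∈ B -> y ∈ B -> vpair t x ∈ K -> vpair t y ∈ K -> x = y].

(** The indices of the members of [A] form a set of natural numbers, which [M] contains, and [K]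
    decodes it. *)
Lemma M_countable_sub A B : M_countable B -> A ⊆ B -> M A.
Proof.
move=> [MB [K [MK Kex Kinj]]] AB.
pose w := vsep omega (fun t => exists2 x, x ∈ A & vpair t x ∈ K).
have Mw : M w by apply: M_sub_omega => t /vsepP [].
apply: (@M_separation (fun e => exists t, M t /\ (t ∈ e 1 /\ vpair t (e 0) ∈ e 2))
  [:: w; K] B) => //=.
  by definability.
move=> x; split=> [xA|[xB [t [_ [/vsepP [_ [y yA ty]] tx]]]]].
- have [t tw tx] := Kex _ (AB _ xA); split; first exact: AB.
  exists t; split; first exact: M_trans M_omega tw.
  by split=> //; apply/vsepP; split=> //; exists x.
- by rewrite (Kinj _ _ _ xB (AB _ yA) tx ty).
Qed.

(** Built by adding one pair at a time, so that membership in [M] follows by induction on [t]; these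
    are the approximations from which [M] obtains the enumeration. *)
Fixpoint diag_segment (t : nat) : V :=
  let p := vpair (vnat t) (vdiag t) in
  vunion (vupair (if t is s.+1 then diag_segment s else vempty) (vupair p p)).

Lemma diag_segmentP t p : p ∈ diag_segment t <->
  exists2 s, s <= t & p = vpair (vnat s) (vdiag s).
Proof.
elim: t p => [|t IH] p; split.
- move=> /vunionP [y [/vupairP [->|->]]]; first by move/vemptyP.
  by move=> /vupairP h; exists 0 => //; case: h.
- move=> [[|s] // _ ->]; apply/vunionP; eexists; split.
    by apply/vupairP; right.
  by apply/vupairP; left.
- move=> /vunionP [y [/vupairP [->|->]]].
    by move=> /IH [s st ->]; exists s => //; exact: leqW.
  by move=> /vupairP h; exists t.+1 => //; case: h.
- move=> [s]; rewrite leq_eqVlt => /orP [/eqP ->|st] ->; apply/vunionP; eexists.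
    by split; [apply/vupairP; right|apply/vupairP; left].
  by split; [apply/vupairP; left|apply/IH; exists s].
Qed.

Lemma M_vdiag t : M (vdiag t).
Proof. by apply: M_vpair; exact: M_vnat. Qed.

Lemma M_diag_segment t : M (diag_segment t).
Proof.
have Mp s : M (vpair (vnat s) (vdiag s)).
  by apply: M_vpair; [exact: M_vnat|exact: M_vdiag].
elim: t => [|t IH]; apply: M_vunion; apply: M_vupair => //; try exact: M_vupair.
exact: M_vempty.
Qed.

(* The graph of the diagonal enumeration is the union of all sets [j] in [M]
   each of whose members either starts the recursion or is obtained by a
   recursion step from another member. *)
Lemma M_countable_omega2 : M_countable (vprod omega omega).
Proof.
have Mo := M_omega; have Moo := M_vprod Mo Mo; split=> //.
pose K := vsup (fun t => vpair (vnat t) (vdiag t)).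
exists K; split.
(* The parameter [e 1] is [vempty], the number 0. The two last alternatives are the clauses of
   [diag_next]: from (n, m+1) to (n+1, m), and from (n, 0) to (0, n+1). *)
- apply: (@M_separation (fun e => exists j, M j /\ (e 0 ∈ j /\
    forall t, M t -> forall q, M q -> vpair t q ∈ j ->
      (t = e 1 /\ q = vpair (e 1) (e 1)) \/
      (exists t', M t' /\ exists q', M q' /\ (vpair t' q' ∈ j /\ (t = vsucc t' /\
        exists n, M n /\ exists m, M m /\ exists n1, M n1 /\ exists m1, M m1 /\
          (n1 = vsucc n /\ (m1 = vsucc m /\
          ((q' = vpair n m1 /\ q = vpair n1 m) \/
           (q' = vpair n (e 1) /\ q = vpair (e 1) n1))))))))) [:: vempty]
    (vprod omega (vprod omega omega))) => /=.
  + by definability.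
  + exact: M_vprod.
  + by split=> //; exact: M_vempty.
  + move=> p; split=> [/vsupP [s ->]|[]].
      split.
        by do !(apply/vpair_prodP; split); exact: vnat_omega.
      exists (diag_segment s); split; first exact: M_diag_segment.
      split; first by apply/diag_segmentP; exists s.
      move=> t _ q _ /diag_segmentP [[|r] rs /vpair_inj[-> ->]]; first by left.
      right; exists (vnat r); split; first exact: M_vnat.
      exists (vdiag r); split; first exact: M_vdiag.
      split; first by apply/diag_segmentP; exists r => //; exact: ltnW.
      split=> //; rewrite /vdiag [diag r.+1]iterS -/(diag r).
      case: (diag r) => n m.
      exists (vnat n); split; first exact: M_vnat.
      (* For [m] equal to 0 this witness is a dummy: the clause that then applies does not mention
         it. *)
      exists (vnat m.-1); split; first exact: M_vnat.
      exists (vnat n.+1); split; first exact: M_vnat.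
      exists (vnat m.-1.+1); split; first exact: M_vnat.
      do 2 split=> //.
      by case: m => [|m] /=; [right|left].
    move=> /vprodP [_ [q [/omegaP [t ->] _ ->]]] [j [Mj [tj jP]]].
    apply/vsupP; exists t; congr vpair.
    elim: t q tj => [|t IH] q tj.
      have Mtq := M_trans Mj tj; have [Mt Mq] := M_vpair_inv Mtq.
      have [[_ ->] //|[t' [_ [q' [_ [_ [e _]]]]]]] := jP _ Mt _ Mq tj.
      by case: (@vsucc_neq0 t').
    have Mtq := M_trans Mj tj; have [Mt Mq] := M_vpair_inv Mtq.
    have [[e _]|[t' [_ [q' [_ [q'j [/vsucc_inj e step]]]]]]] := jP _ Mt _ Mq tj.
      by case: (@vsucc_neq0 (vnat t)).
    rewrite -e in q'j; have e' := IH _ q'j; move: step.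
    rewrite {}e' /vdiag [diag t.+1]iterS -/(diag t); case: (diag t) => n m /=.
    move=> [n' [_ [m' [_ [n1 [_ [m1 [_ [-> [-> step]]]]]]]]]].
    case: step => -[/vpair_inj[<- em] ->].
      by case: m em => [/= /esym/vsucc_neq0 //|m /= /vsucc_inj <-].
    by case: m em => [//|m /= /vsucc_neq0].
- move=> _ /vprodP [_ [_ [/omegaP [n ->] /omegaP [m ->] ->]]].
  have [t e] := diag_surj n m; exists (vnat t); first exact: vnat_omega.
  by apply/vsupP; exists t; rewrite /vdiag e.
- move=> t x y _ _ /vsupP [s /vpair_inj[-> ->]] /vsupP [r /vpair_inj[/vnat_inj-> ->]] //.
Qed.

(* A bijection of [a] with a set of natural numbers transports the membership
   relation of [a] to a relation [W], which [M] contains, and [M] recovers the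
   bijection as the union of all its sets that collapse [W] correctly. *)
Lemma M_countable_ordinal a : ordinal a -> vcountable a -> M_countable a.
Proof.
move=> oa /vcountableP [i iinj]; split; first exact: M_ordinal.
pose I := vimage (fun x => vnat (i x)) a.
have IP n : n ∈ I <-> exists x, x ∈ a /\ n = vnat (i x) by exact: vimageP.
have MI : M I by apply: M_sub_omega => _ /IP [x [_ ->]]; exact: vnat_omega.
pose W := vsep (vprod omega omega) (fun p => exists x y,
  [/\ x ∈ y, y ∈ a & p = vpair (vnat (i x)) (vnat (i y))]).
have MW : M W by apply: (M_countable_sub M_countable_omega2) => p /vsepP [].
have WP m y : y ∈ a -> vpair m (vnat (i y)) ∈ W <->
    exists2 x, x ∈ y & m = vnat (i x).
  move=> ya; split=> [/vsepP [_ [x [y' [xy ya' /vpair_inj[-> /vnat_inj e]]]]]|].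
    by exists x => //; rewrite (iinj y y').
  move=> [x xy ->]; apply/vsepP; split; last by exists x, y.
  by apply/vpair_prodP; split; exact: vnat_omega.
pose D b := vimage (fun x => vpair (vnat (i x)) x) b.
have DmemP b p : p ∈ D b <-> exists x, x ∈ b /\ p = vpair (vnat (i x)) x.
  exact: vimageP.
have DP b n x : vpair n x ∈ D b <-> x ∈ b /\ n = vnat (i x).
  split=> [/DmemP [y [yb /vpair_inj[-> ->]]] //|[xb ->]].
  by apply/DmemP; exists x.
have sub b : b ∈ vsucc a -> b ⊆ a.
  by move=> /vsuccP [ba|-> //] x; exact: ordinal_trans.
(* [D b] is the coding bijection restricted to [b]. The induction has to reach [a] itself, hence
   runs over [vsucc a]. *)
suff MD b : b ∈ vsucc a -> M (D b).
  exists (D a); split=> [|x xa|t x y xa ya].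
  - by apply: MD; apply/vsuccP; right.
  - by exists (vnat (i x)); [exact: vnat_omega|apply/DP].
  - move=> /DP [_ ->] /DP [_ /vnat_inj]; exact: iinj.
elim/vmem_ind: b => b IH bs; have ba := sub _ bs.
have ob : ordinal b by apply: ordinal_mem bs; exact: ordinal_vsucc.
(* The conditions on [j] are local: [y] consists of the [j]-values at the [W]-predecessors of [n],
   and each of these has a value. *)
apply: (@M_separation (fun e => exists j, M j /\ (e 0 ∈ j /\
  forall n, M n -> forall y, M y -> vpair n y ∈ j ->
    (forall z, M z -> (z ∈ y <->
       exists m, M m /\ (vpair m n ∈ e 1 /\ vpair m z ∈ j))) /\
    (forall m, M m -> vpair m n ∈ e 1 -> exists z, M z /\ vpair m z ∈ j)))
  [:: W] (vprod I b)) => /=.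
- by definability.
- by apply: M_vprod => //; exact: M_ordinal.
- by [].
move=> p; split.
  move=> /DmemP [x [xb ->]]; have xa := ba _ xb.
  split; first by apply/vpair_prodP; split=> //; apply/IP; exists x.
  have bx : x ∈ vsucc a by apply/vsuccP; left.
  have Mx : M x by apply: M_ordinal; exact: ordinal_mem xb.
  (* This set is closed under [W]-predecessors, and it arises by adding one pair to [D x], which is
     in [M] by induction. *)
  exists (D (vsucc x)); split.
    have -> : D (vsucc x) = vunion (vupair (D x)
        (vupair (vpair (vnat (i x)) x) (vpair (vnat (i x)) x))).
      apply: vext => q; split.
      - move=> /DmemP [y [/vsuccP [yx|->] ->]]; apply/vunionP; eexists; split.
        + by apply/vupairP; left.
        + by apply/DP.
        + by apply/vupairP; right.
        + by apply/vupairP; left.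
      - move=> /vunionP [_ [/vupairP [->|->]]].
          move=> /DmemP [y [yx ->]]; apply/DP; split=> //.
          by apply/vsuccP; left.
        by move=> /vupairP [] ->; apply/DP; split=> //; apply/vsuccP; right.
    apply/M_vunion/M_vupair; first exact: IH.
    by apply: M_vupair; apply: M_vpair => //; exact: M_vnat.
  split; first by apply/DP; split=> //; apply/vsuccP; right.
  have tx y z : y ∈ vsucc x -> z ∈ y -> z ∈ vsucc x.
    by apply: ordinal_trans; apply/ordinal_vsucc; exact: ordinal_mem xb.
  have sa y : y ∈ vsucc x -> y ∈ a.
    by move=> /vsuccP [yx|-> //]; exact: ordinal_trans yx.
  move=> _ _ y My /DP [yx ->]; split=> [z Mz|m Mm]; rewrite ?WP; try exact: sa.
    split=> [zy|[m [_ []]]].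
      exists (vnat (i z)); split; first exact: M_vnat.
      split; first by apply/WP; [exact: sa|exists z].
      by apply/DP; split=> //; exact: tx zy.
    move=> /WP [|z' z'y ->]; first exact: sa.
    move=> /DP [zx /vnat_inj/iinj <-] //; last exact: sa.
    by apply: sa; exact: tx z'y.
  move=> [z zy ->]; exists z; split; first exact: M_trans zy.
  by apply/DP; split=> //; exact: tx zy.
move=> [/vprodP [_ [y [/IP [x [xa ->]] yb ->]]] [j [Mj [pj jP]]]].
suff e : y = x by apply/DP; rewrite -e.
(* Uniqueness of the collapse: by induction on [x], an admissible [j] has only the value [x] at the
   code of [x]. *)
move: pj {yb}; elim/vmem_ind: x y xa => x IHx y xa pj.
have Mp := M_trans Mj pj; have [Mn My] := M_vpair_inv Mp.
have [h1 h2] := jP _ Mn _ My pj; apply: vext => z; split.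
- move=> zy; have Mz := M_trans My zy.
  have [m [Mm [/WP [//|w wx ->] zj]]] := iffLR (h1 _ Mz) zy.
  by rewrite (IHx w wx z) //; exact: ordinal_trans wx.
- move=> zx; have za : z ∈ a by exact: ordinal_trans zx.
  have zW : vpair (vnat (i z)) (vnat (i x)) ∈ W by apply/WP => //; exists z.
  have [z' [Mz' z'j]] := h2 _ (M_vnat _) zW.
  have e := IHx z zx z' za z'j; rewrite e in Mz' z'j.
  by apply/h1 => //; exists (vnat (i z)); split; first exact: M_vnat.
Qed.

(** The enumerations of [A] and [B] carry [Q] to a set of pairs of natural numbers, which lies in
    [M], and [M] carries it back. *)
Lemma M_countable_sub_vprod A B Q : M_countable A -> M_countable B ->
  Q ⊆ vprod A B -> M Q.
Proof.
move=> [MA [K [MK Kex Kinj]]] [MB [L [ML Lex Linj]]] QAB.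
pose Q' := vsep (vprod omega omega) (fun p => exists t u x y,
  p = vpair t u /\ [/\ vpair t x ∈ K, vpair u y ∈ L & vpair x y ∈ Q]).
have MQ' : M Q' by apply: (M_countable_sub M_countable_omega2) => p /vsepP [].
apply: (@M_separation (fun e => exists x, M x /\ exists y, M y /\ exists t, M t /\
  exists u, M u /\ (e 0 = vpair x y /\ (vpair t u ∈ e 1 /\
  (vpair t x ∈ e 2 /\ vpair u y ∈ e 3)))) [:: Q'; K; L] (vprod A B)) => //=.
- by definability.
- exact: M_vprod.
move=> p; split=> [pQ|].
  have pAB := QAB _ pQ; split=> //; case/vprodP: (pAB) pQ => [x [y [xA yB ->]]] pQ.
  have [[t tw tx] [u uw uy]] := (Kex _ xA, Lex _ yB).
  exists x; split; first exact: M_trans xA.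
  exists y; split; first exact: M_trans yB.
  exists t; split; first exact: M_trans M_omega tw.
  exists u; split; first exact: M_trans M_omega uw.
  split=> //; split=> //; apply/vsepP; split; first exact/vpair_prodP.
  by exists t, u, x, y.
move=> [pAB [x [_ [y [_ [t [_ [u [_ [e [/vsepP [_ q] [tx uy]]]]]]]]]]]].
subst p; case/vpair_prodP: pAB => xA yB.
case: q => [t' [u' [x' [y' [/vpair_inj[<- <-] [tx' uy' xyQ]]]]]].
have /vpair_prodP [xA' yB'] := QAB _ xyQ.
by rewrite (Kinj _ _ _ xA xA' tx tx') (Linj _ _ _ yB yB' uy uy').
Qed.

(** Each such function is a subset of [vprod A B], hence in [M]; so the power set of the product in
    [M] misses none of them. *)
Lemma M_vfuns A B : M_countable A -> M_countable B -> M (vfuns A B).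
Proof.
move=> cA cB; have MAB := M_vprod cA.1 cB.1; have [p Mp pP] := M_power MAB.
apply: (@M_separation (fun e => forall x, M x -> x ∈ e 1 ->
  exists y, M y /\ (vpair x y ∈ e 0 /\ forall z, M z -> vpair x z ∈ e 0 -> y = z))
  [:: A] p) => //=.
- by definability.
- by split=> //; exact: cA.1.
move=> f; split.
  move=> ff; have fAB : f ⊆ vprod A B by move: ff => /vsepP [/vpowerP].
  have Mf := M_countable_sub_vprod cA cB fAB; split; first exact/pP.
  case/vfunsP: ff => _ fu x _ /fu [y [xy yu]].
  have /M_vpair_inv [_ My] := M_trans Mf xy.
  by exists y; split=> //; split=> // z _; exact: yu.
move=> [/pP [Mf fAB] fu]; apply/vfunsP; split=> [q /fAB /vprodP //|x xA].
have [y [_ [xy yu]]] := fu _ (M_trans cA.1 xA) xA.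
exists y; split=> // z xz; apply: yu => //.
by have /M_vpair_inv [_ Mz] := M_trans Mf xz.
Qed.

(* [x] agrees with [h] along one of the sequences [k |-> E(n, k)], [n] in [N]. *)
Definition guessed (N E h x : V) : Prop :=
  exists2 n, n ∈ N & forall k b, vpair (vpair n k) b ∈ E ->
    exists2 i, vpair k i ∈ x & vpair b i ∈ h.

(** [N] and [E] are in [M], being subsets of sets countable in [M]; the map is then separated from
    the product of [vfuns a a] with the power set of [reals] in [M]. *)
Lemma M_guessed a N E : ordinal a -> vcountable a ->
  N ⊆ omega -> E ⊆ vprod (vprod omega omega) a ->
  M (vgraph (fun h => vsep reals (guessed N E h)) (vfuns a a)).
Proof.
move=> oa ca Nw Ea.
have cM := M_countable_ordinal oa ca.
have MN := M_sub_omega Nw.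
have ME := M_countable_sub_vprod M_countable_omega2 cM Ea.
have Mr : M reals.
  apply: M_vfuns; apply: M_countable_ordinal; try exact: ordinal_omega.
  - exact: vcountable_vsup.
  - exact: (ordinal_vnat 2).
  - by apply: vcountable_range; exists vnat => x /vnat_memP [m _ ->]; exists m.
have Mf := M_vfuns cM cM.
have [p Mp pP] := M_power Mr.
(* Quantifiers are bounded by [M], and [q] names the inner pair because the definable atoms involve
   only pairs of variables. *)
pose Psi h x := exists n, M n /\ (n ∈ N /\ forall k, M k -> forall b, M b ->
  forall q, M q -> q = vpair n k -> vpair q b ∈ E ->
  exists i, M i /\ (vpair k i ∈ x /\ vpair b i ∈ h)).
have guessedP h x : M h -> M x -> guessed N E h x <-> Psi h x.
  move=> Mh Mx; split=> [[n nN nP]|[n [_ [nN nP]]]].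
    exists n; split; first exact: M_trans nN.
    split=> // k _ b _ _ _ -> /nP [i xi hi]; exists i; split=> //.
    by have /M_vpair_inv [] := M_trans Mx xi.
  exists n => // k b nk; have /M_vpair_inv [Mq Mb] := M_trans ME nk.
  have [_ Mk] := M_vpair_inv Mq.
  by have [i [_ [xi hi]]] := nP _ Mk _ Mb _ Mq erefl nk; exists i.
apply: (@M_separation (fun e => exists h, M h /\ exists y, M y /\
  (e 0 = vpair h y /\ forall x, M x -> x ∈ e 1 -> (x ∈ y <->
    exists n, M n /\ (n ∈ e 2 /\ forall k, M k -> forall b, M b ->
      forall q, M q -> q = vpair n k -> vpair q b ∈ e 3 ->
      exists i, M i /\ (vpair k i ∈ x /\ vpair b i ∈ h)))))
  [:: reals; N; E] (vprod (vfuns a a) p)) => //=.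
- by definability.
- exact: M_vprod.
have Mval h : M h -> M (vsep reals (guessed N E h)).
  move=> Mh; apply: (@M_separation (fun e => exists n, M n /\ (n ∈ e 2 /\
      forall k, M k -> forall b, M b ->
      forall q, M q -> q = vpair n k -> vpair q b ∈ e 3 ->
      exists i, M i /\ (vpair k i ∈ e 0 /\ vpair b i ∈ e 1)))
    [:: h; N; E] reals) => //=.
    by definability.
  move=> x; split=> [/vsepP [xr g]|[xr g]].
    by split=> //; apply/(guessedP h x) => //; exact: M_trans xr.
  by apply/vsepP; split=> //; apply/guessedP => //; exact: M_trans xr.
move=> q; split=> [/vgraph_memP [h [hf ->]]|].
  have Mh := M_trans Mf hf; split.
    apply/vpair_prodP; split=> //; apply/pP; split; first exact: Mval.
    by move=> x /vsepP [].
  exists h; split=> //; exists (vsep reals (guessed N E h)).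
  split; first exact: Mval.
  split=> // x Mx xr; split=> [/vsepP [_] /guessedP|g]; first by apply.
  by apply/vsepP; split=> //; apply/guessedP.
move=> [/vprodP [h' [y' [hf /pP [My' yr'] ->]]] [h [Mh [y [My [e hy]]]]]].
case/vpair_inj: e => ? ?; subst h' y'; apply/vgraphP; split=> //.
apply: vext => x; split=> [xy|/vsepP [xr g]].
  apply/vsepP; split; first exact: yr'.
  have Mx := M_trans My xy; apply/guessedP => //.
  by apply/hy => //; exact: yr'.
have Mx := M_trans Mr xr; apply/hy => //.
by apply/(guessedP h x).
Qed.

End InnerModel.

(** * Heights in a tree *)

Section Tree.
Variables T R : V.
Hypothesis treeT : tree T R.

Lemma predecessorsP s t : t ∈ predecessors T R s <-> t ∈ T /\ tlt R t s.
Proof. exact: vsepP. Qed.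

Lemma predecessors_sub s t : t ∈ predecessors T R s -> t ∈ T.
Proof. by case/predecessorsP. Qed.

Lemma predecessors_trans s t u :
  t ∈ predecessors T R s -> u ∈ predecessors T R t -> u ∈ predecessors T R s.
Proof.
have [[_ _ anti tr] _] := treeT.
move=> /predecessorsP [tT [ts nts]] /predecessorsP [uT [ut nut]].
apply/predecessorsP; split=> //; split; first exact: tr ts.
by move=> us; apply: nut; apply: anti ut _; rewrite us.
Qed.

(** A well order is specified through minima, so the least element of the two-element set
    decides. *)
Lemma predecessors_linear s t u : s ∈ T ->
  t ∈ predecessors T R s -> u ∈ predecessors T R s ->
  [\/ tlt R t u, t = u | tlt R u t].
Proof.
have [_ wo] := treeT => /wo [_ _ min] ts us.
have [|e|m] := min (vupair t u); first by move=> x /vupairP [] ->.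
  by apply: (@vemptyP t); rewrite -e; apply/vupairP; left.
case/vupairP => -> h.
- have [|->|] := h u; [by apply/vupairP; right|exact: Or32|exact: Or31].
- have [|->|] := h t; [by apply/vupairP; left|exact: Or32|exact: Or33].
Qed.

(** If a predecessor of [s] were inaccessible, a least such one would have only accessible
    predecessors, hence be accessible. *)
Lemma tree_wf : well_founded (fun t s => s ∈ T /\ t ∈ predecessors T R s).
Proof.
set r := fun t s => _; move=> s; constructor=> t [sT ts].
apply: contrapT => nt.
have [_ /(_ _ sT) [_ _ min]] := treeT.
pose B := vsep (predecessors T R s) (fun u => ~ Acc r u).
have [|e|m /vsepP [ms nm] mmin] := min B; first by move=> x /vsepP [].
  by apply: (@vemptyP t); rewrite -e; apply/vsepP.
apply: nm; constructor=> u [_ um]; apply: contrapT => nu.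
have us := predecessors_trans ms um.
have [e|mu] := mmin u (iffRL (vsepP _ _ _) (conj us nu)).
  by case/predecessorsP: um => _ []; rewrite e.
have mu' : m ∈ predecessors T R u.
  by apply/predecessorsP; split=> //; exact: predecessors_sub ms.
by case/predecessorsP: (predecessors_trans um mu') => _ [].
Qed.

Lemma tree_ind (P : V -> Prop) :
  (forall s, s ∈ T -> (forall t, t ∈ predecessors T R s -> P t) -> P s) ->
  forall s, s ∈ T -> P s.
Proof.
move=> IH s; elim: (tree_wf s) => {}s _ IHs sT; apply: IH => // t ts.
by apply: IHs => //; exact: predecessors_sub ts.
Qed.

(** [H] is the Mostowski collapse of the tree order. It maps the predecessors of [s] isomorphically
    onto the ordinal [H s], so the description in [height] is met, and any isomorphism onto an
    ordinal agrees with [H] by induction. *)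
Lemma height_collapse : exists H : V -> V,
  (forall s, s ∈ T -> H s = vimage H (predecessors T R s)) /\
  forall s, s ∈ T -> ordinal (H s) /\ height T R s = H s.
Proof.
pose G s (g : V -> V) :=
  if pselect (s ∈ T) then vimage g (predecessors T R s) else vempty.
have [H HE] : exists H, forall x, H x = G x H.
  apply: (wf_recursion tree_wf) => s g g' gg'; rewrite /G; case: pselect => // sT.
  apply: vext => y; split=> /vimageP [t [ts ->]]; apply/vimageP; exists t.
  - by split=> //; exact: gg'.
  - by split=> //; symmetry; exact: gg'.
have {}HE s : s ∈ T -> H s = vimage H (predecessors T R s).
  by move=> sT; rewrite HE /G; case: pselect.
have HP s x : s ∈ T -> x ∈ H s <-> exists t, t ∈ predecessors T R s /\ x = H t.
  by move=> sT; rewrite HE //; exact: vimageP.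
have oH s : s ∈ T -> ordinal (H s).
  apply: (tree_ind (P := fun s => ordinal (H s))) => {}s sT IH.
  apply: ordinal_of_transitive => x /HP -/(_ sT) [t [ts ->]]; last exact: IH.
  move=> y /HP [|u [ut ->]]; first exact: predecessors_sub ts.
  by apply/HP => //; exists u; split=> //; exact: predecessors_trans ut.
exists H; split=> // s sT; split; first exact: oH.
have ltH t u : t ∈ predecessors T R s -> u ∈ predecessors T R s ->
    tlt R t u <-> H t ∈ H u.
  move=> ts us; have [tT uT] := (predecessors_sub ts, predecessors_sub us).
  have lt x y : x ∈ T -> y ∈ T -> tlt R x y -> H x ∈ H y.
    by move=> xT yT xy; apply/HP => //; exists x; split=> //; apply/predecessorsP.
  split=> [|htu]; first exact: lt.
  have [//|e|ut] := predecessors_linear sT ts us.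
    by rewrite e in htu; case: (vmem_irr htu).
  by case: (vmem_asym htu (lt _ _ uT tT ut)).
have isoH : order_isomorphic (predecessors T R s) (tlt R) (H s) vmem.
  exists (vgraph H (predecessors T R s)); last first.
    by move=> t u ts us; rewrite !app_vgraph //; exact: ltH.
  split; last first.
    by move=> y /HP -/(_ sT) [t [ts ->]]; exists t => //; rewrite app_vgraph.
  split; first by apply: vgraph_vfuns => t ts; apply/HP => //; exists t.
  move=> t u ts us; rewrite !app_vgraph // => e.
  have [/(ltH _ _ ts us)|//|/(ltH _ _ us ts)] := predecessors_linear sT ts us;
    by rewrite e => /vmem_irr.
have [oa [h [[hf hinj] hsurj] hiso]] :
    ordinal (height T R s) /\
    order_isomorphic (predecessors T R s) (tlt R) (height T R s) vmem.
  apply: (@theP (fun a => ordinal a /\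
    order_isomorphic (predecessors T R s) (tlt R) a vmem)).
  by exists (H s); split=> //; exact: oH.
have hH t : t ∈ predecessors T R s -> app h t = H t.
  move=> ts; have tT := predecessors_sub ts; move: tT ts.
  apply: (tree_ind (P := fun t => t ∈ predecessors T R s -> app h t = H t)).
  move=> {}t tT IH ts; apply: vext => z; split.
  - move=> zt; have za : z ∈ height T R s.
      by apply: ordinal_trans zt => //; exact: (app_vfuns hf ts).2.
    have [u us e] := hsurj _ za; rewrite -e in zt *.
    have ut : u ∈ predecessors T R t.
      by apply/predecessorsP; split; [exact: predecessors_sub us|exact/hiso].
    by apply/HP => //; exists u; split=> //; exact: IH.
  - move=> /HP -/(_ tT) [u [ut ->]]; have us := predecessors_trans ts ut.
    rewrite -IH //; apply/hiso => //.
    by case/predecessorsP: ut.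
apply: vext => z; split.
- by move=> /hsurj [t ts <-]; rewrite hH //; apply/HP => //; exists t.
- by move=> /HP -/(_ sT) [t [ts ->]]; rewrite -hH //; exact: (app_vfuns hf ts).2.
Qed.

Lemma height_ordinal s : s ∈ T -> ordinal (height T R s).
Proof. by have [H [_ h]] := height_collapse => /h [? ->]. Qed.

Lemma heightP s x : s ∈ T -> x ∈ height T R s <->
  exists t, t ∈ predecessors T R s /\ height T R t = x.
Proof.
have [H [HE h]] := height_collapse => sT.
rewrite (h _ sT).2 HE //; split=> [/vimageP [t [ts ->]]|[t [ts <-]]].
- by exists t; split=> //; exact: (h _ (predecessors_sub ts)).2.
- by apply/vimageP; exists t; split=> //; exact: (h _ (predecessors_sub ts)).2.
Qed.

Lemma node_restrictP s x : s ∈ T -> x ∈ height T R s ->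
  node_restrict T R s x ∈ predecessors T R s /\
  height T R (node_restrict T R s x) = x.
Proof.
move=> sT /(heightP _ sT) h.
exact: (@theP (fun t => t ∈ predecessors T R s /\ height T R t = x)).
Qed.

(** A node of height [omega1] or more would be, or have as a predecessor, a node of height exactly
    [omega1]. *)
Lemma height_omega1 s : ordinal omega1 -> level T R omega1 = vempty ->
  s ∈ T -> height T R s ∈ omega1.
Proof.
move=> o1 l1 sT; have [//|e|h] := ordinal_trichotomy (height_ordinal sT) o1.
  by case: (@vemptyP s); rewrite -l1; apply/vsepP.
have [/predecessors_sub nT e] := node_restrictP sT h.
by case: (@vemptyP (node_restrict T R s omega1)); rewrite -l1; apply/vsepP.
Qed.

End Tree.

(** * Coding an aleph_1-tree by countable ordinals *)

Lemma iter_vsucc_lt n m x : n < m -> iter n vsucc x ∈ iter m vsucc x.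
Proof.
elim: m => // m IH; rewrite ltnS leq_eqVlt => /orP [/eqP ->|/IH h].
- by apply/vsuccP; right.
- by apply/vsuccP; left.
Qed.

Lemma iter_vsucc_sub n x y : y ∈ x -> y ∈ iter n vsucc x.
Proof. by elim: n => // n IH /IH h; apply/vsuccP; left. Qed.

Lemma iter_vsucc_inj x n m : iter n vsucc x = iter m vsucc x -> n = m.
Proof.
by move=> e; case: (ltngtP n m) => // /iter_vsucc_lt -/(_ x); rewrite e => /vmem_irr.
Qed.

(** * Blocks of ordinals and the club of ordinals closed under them *)

Section Omega1.
Hypothesis lu : least_uncountable omega1.

(* The witness for [B a] is the ordinal product of omega and [a]. *)
Lemma exists_blocks : exists B : V -> V,
  (forall a, a ∈ omega1 -> B a ∈ omega1) /\
  (forall a b n, a ∈ b -> iter n vsucc (B a) ∈ B b).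
Proof.
pose add x := vunion (vsup (fun n => iter n vsucc x)).
have addP x y : y ∈ add x <-> exists n, y ∈ iter n vsucc x.
  split=> [/vunionP [_ [/vsupP [n ->]]]|[n yn]]; first by exists n.
  by apply/vunionP; exists (iter n vsucc x); split=> //; apply/vsupP; exists n.
(* As [add x] is x + omega, [B x] is the supremum of [B y] + omega over [y] in [x]. *)
have [B BE] : exists B, forall x, B x = vunion (vimage (fun y => add (B y)) x).
  apply: (@wf_recursion _ (fun x g => vunion (vimage (fun y => add (g y)) x)) vmem_wf).
  move=> x g g' gg'; congr vunion; apply: vext => z.
  by split=> /vimageP [y [yx ->]]; apply/vimageP; exists y; split=> //; rewrite gg'.
exists B; split=> [|a b n ab].
  elim/vmem_ind => a IH aw; have [o1 _ c1] := lu.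
  rewrite BE; apply: omega1_vunion => //; first by apply: vcountable_image; exact: c1.
  move=> _ /vimageP [y [ya ->]]; apply: omega1_vunion => //.
    exact: vcountable_vsup.
  move=> _ /vsupP [n ->]; elim: n => [|n IHn] /=; last exact: omega1_vsucc.
  by apply: IH => //; exact: ordinal_trans ya.
rewrite [B b]BE; apply/vunionP; exists (add (B a)).
split; first by apply/vimageP; exists a.
by apply/addP; exists n.+1; exact: iter_vsucc_lt.
Qed.

Variable B : V -> V.
Hypothesis B1 : forall a, a ∈ omega1 -> B a ∈ omega1.
Hypothesis Bblock : forall a b n, a ∈ b -> iter n vsucc (B a) ∈ B b.

(** At such an [a] whole blocks stay below [a]; hence so do the codes of all nodes of height below
    [a]. *)
Definition closed_limits : V :=
  vsep Lim1 (fun a => forall x, x ∈ a -> B x ∈ a).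

Lemma closed_limitsP a : a ∈ closed_limits <->
  [/\ a ∈ omega1, limit_ordinal a & forall x, x ∈ a -> B x ∈ a].
Proof.
split=> [/vsepP [/vsepP []]//|[? ? ?]].
by apply/vsepP; split=> //; apply/vsepP.
Qed.

Lemma closed_limits_block a x n : a ∈ closed_limits -> x ∈ a ->
  iter n vsucc (B x) ∈ a.
Proof.
move=> /closed_limitsP [_ [_ _ lim] Ba] xa.
by elim: n => [|n IH]; [exact: Ba|exact: lim].
Qed.

Lemma club_closed_limits : club closed_limits.
Proof.
have [o1 _ _] := lu; have o1m x : x ∈ omega1 -> ordinal x by exact: ordinal_mem.
split; first split.
- by move=> a /closed_limitsP [].
- move=> b bw.
  have subB x : x ∈ omega1 -> x ⊆ B x.
    elim/vmem_ind: x => x IH xw y yx.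
    have yw : y ∈ omega1 by exact: ordinal_trans yx.
    have By := Bblock 0 yx.
    have [e|yB] := ordinal_sub (o1m _ yw) (o1m _ (B1 yw)) (IH _ yx yw).
      by rewrite {1}e.
    by apply: ordinal_trans yB => //; exact/o1m/B1.
  (* The supremum of the [d n] is closed under [B], and it is a limit because [subB] makes the
     sequence strictly increasing. Starting at [vsucc b] puts [b] below it. *)
  pose d n := iter n (fun x => vsucc (B x)) (vsucc b).
  have d1 n : d n ∈ omega1.
    by elim: n => [|n IH]; apply: omega1_vsucc => //; exact: B1.
  have dd n x : x ∈ B (d n) -> x ∈ d n.+1 by move=> h; apply/vsuccP; left.
  have ddS n : d n ∈ d n.+1.
    have [e|] := ordinal_sub (o1m _ (d1 n)) (o1m _ (B1 (d1 n))) (subB _ (d1 n)).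
      by apply/vsuccP; right.
    exact: dd.
  pose a := vunion (vsup d).
  have aP x : x ∈ a <-> exists n, x ∈ d n.
    split=> [/vunionP [_ [/vsupP [n ->]]]|[n xn]]; first by exists n.
    by apply/vunionP; exists (d n); split=> //; apply/vsupP; exists n.
  have aw : a ∈ omega1.
    by apply: omega1_vunion => //; [exact: vcountable_vsup|move=> _ /vsupP [n ->]].
  have ba : b ∈ a by apply/aP; exists 0; apply/vsuccP; right.
  exists a; split=> //; last by right.
  apply/closed_limitsP; split=> //.
    split; first exact: o1m.
    - by move=> e; rewrite e in ba; exact: vemptyP ba.
    - move=> x /aP [n xn]; have ox : ordinal x by apply: ordinal_mem xn; exact: o1m.
      have [|e|h] := @ordinal_sub (vsucc x) (d n) (ordinal_vsucc ox) (o1m _ (d1 n)).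
      + move=> y /vsuccP [yx|-> //]; apply: ordinal_trans yx => //; exact: o1m.
      + by apply/aP; exists n.+1; rewrite e.
      + by apply/aP; exists n.
  by move=> x /aP [n xn]; apply/aP; exists n.+1; apply: dd; exact: (Bblock 0).
- move=> a /vsepP [aw la] [_ unb]; apply/closed_limitsP; split=> // x xa.
  have [_ _ lim] := la.
  (* [unbounded_in] gives only a point at or above its argument, so it is used at [vsucc x] to get
     one above [x]. *)
  have [c [/vsepP [/closed_limitsP [_ _ Bc] _] ca xc]] := unb _ (lim _ xa).
  have xs : x ∈ vsucc x by apply/vsuccP; right.
  have oc : ordinal c by apply: ordinal_mem ca; exact: o1m.
  have xc' : x ∈ c by case: xc => [<- //|h]; exact: ordinal_trans xs.
  by apply: (ordinal_trans (o1m _ aw) ca); exact: Bc.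
Qed.

End Omega1.

(** A node of height [a] gets the code [B a] + n, where n is its index in the countable level;
    blocks at distinct heights are disjoint by the hypothesis on [B]. *)
Lemma exists_code T R B : aleph1_tree T R ->
  (forall a b n, a ∈ b -> iter n vsucc (B a) ∈ B b) ->
  exists c : V -> V,
    (forall t, t ∈ T -> exists n, c t = iter n vsucc (B (height T R t))) /\
    forall t u, t ∈ T -> u ∈ T -> c t = c u -> t = u.
Proof.
move=> [[treeT o1 l1 _] lc] Bblock.
have /choice [nu nuP] : forall a, exists nu : V -> nat, a ∈ omega1 ->
    forall s t, s ∈ level T R a -> t ∈ level T R a -> nu s = nu t -> s = t.
  move=> a; have [/lc /vcountableP [nu h]|] := pselect (a ∈ omega1).
    by exists nu.
  by exists (fun=> 0).
pose c t := iter (nu (height T R t) t) vsucc (B (height T R t)).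
exists c; split=> [t tT|t u tT uT e]; first by exists (nu (height T R t) t).
have lt x y : height T R x ∈ height T R y -> c x ∈ c y.
  by move=> h; apply: iter_vsucc_sub; exact: Bblock.
have [/lt|eh|/lt] := ordinal_trichotomy (height_ordinal treeT tT)
  (height_ordinal treeT uT).
- by rewrite e => /vmem_irr.
- move: e; rewrite /c -eh => /iter_vsucc_inj; apply: nuP.
  + exact: height_omega1.
  + exact/vsepP.
  + exact/vsepP.
- by rewrite e => /vmem_irr.
Qed.

(** * Guessing sets *)

(** The closure stays within one point, and Cantor space has no isolated points. *)
Lemma nowhere_dense_subsingleton (A : set cantor_space) :
  (forall x y, A x -> A y -> x = y) -> nowhere_dense A.
Proof.
move=> sA; rewrite /nowhere_dense -subset0 => z zA.
have [[x Ax]|nA] := pselect (exists x, A x); last first.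
  have A0 : A = set0 by rewrite -subset0 => x Ax; apply: nA; exists x.
  by move: (interior_subset zA); rewrite A0 closure0.
have cx : closure A `<=` [set x].
  have /closure_id -> : closed [set x].
    exact/accessible_closed_set1/hausdorff_accessible/cantor_space_hausdorff.
  by apply: closureS => y Ay; exact: sA.
have /perfectTP/(_ x) := cantor_perfect; apply.
rewrite (_ : [set x] = (closure A)°); first exact: open_interior.
rewrite eqEsubset; split=> [y ->|y /interior_subset /cx //].
by rewrite -(cx _ (interior_subset zA)).
Qed.

Lemma real_of_app (r : cantor_space) k : real_of r ∈ reals ->
  app (real_of r) (vnat k) = vnat (r k : bool).
Proof. by move=> rr; apply: (app_vfuns_eq rr); apply/vsupP; exists k. Qed.

Section Guessing.
Variables (D : V) (L : V -> V) (q : V -> V -> nat -> V).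
Hypothesis Lcountable : forall a, a ∈ D -> vcountable (L a).
Hypothesis qa : forall a s k, a ∈ D -> s ∈ L a -> q a s k ∈ a.

(** In the application [D] is the club of closed limits, [L a] is the level [a] of the tree, and
    [q a s k] is the code of the predecessor of [s] at the [k]-th ladder point of [a]. The ordinal
    [a] is determined by [h] as its domain. *)
Definition eventually_along (h x : V) : Prop := exists a s m,
  [/\ a ∈ D, h ∈ vfuns a a, s ∈ L a
    & forall k, m <= k -> app x (vnat k) = app h (q a s k)].

Definition guess_set (h : V) : V := vsep reals (eventually_along h).

(** A member is determined by the node [s], the bound [m] and its first [m] bits; coding these by a
    natural number splits the set into countably many pieces of at most one point. *)
Lemma guess_set_meager h : guess_set h ∈ meager_ideal.
Proof.
apply/vsepP; split; first by apply/vpowerP => x /vsepP [].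
have [[a [aD ha]]|no] := pselect (exists a, a ∈ D /\ h ∈ vfuns a a); last first.
  exists (fun=> set0).
    by move=> n; apply: nowhere_dense_subsingleton.
  rewrite bigcup0 // -subset0 => r /vsepP [_ [a [s [m [aD ha _ _]]]]].
  by apply: no; exists a.
have /vcountableP [nu nuP] := Lcountable aD.
pose N n := [set r : cantor_space | real_of r ∈ reals /\ exists s m,
  [/\ s ∈ L a, forall k, m <= k -> app (real_of r) (vnat k) = app h (q a s k)
    & n = pickle (nu s, m, mkseq r m)]].
exists N.
  move=> n; apply: nowhere_dense_subsingleton.
  move=> x y [xr [s [m [sL xP ->]]]] [yr [s' [m' [sL' yP]]]].
  move=> /(pcan_inj (@pickleK _)) [es em exy]; subst m'.
  have {}es := nuP _ _ sL sL' es; subst s'.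
  apply/funext => k; have [km|mk] := ltnP k m.
    by rewrite -(nth_mkseq false x km) exy nth_mkseq.
  have /vnat_inj : vnat (x k : bool) = vnat (y k : bool).
    by rewrite -!real_of_app // xP // yP.
  by case: (x k) (y k) => [] [].
rewrite eqEsubset; split=> r.
  move=> /vsepP [rr [a' [s [m [aD' ha' sL rP]]]]].
  rewrite -(vfuns_domain_inj ha ha') in sL rP.
  by exists (pickle (nu s, m, mkseq r m)) => //; split=> //; exists s, m.
move=> [n _ [rr [s [m [sL rP _]]]]]; apply/vsepP; split=> //.
by exists a, s, m.
Qed.

(** Brings the guess set into the form required by [M_guessed]: [N] codes the pairs of a node and a
    bound, and [E] lists the values of [q] from the bound on. *)
Lemma guess_set_guessed a : a ∈ omega1 -> exists N E,
  [/\ N ⊆ omega, E ⊆ vprod (vprod omega omega) a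
    & forall h, h ∈ vfuns a a -> guess_set h = vsep reals (guessed N E h)].
Proof.
move=> aw; have [aD|aD] := pselect (a ∈ D); last first.
  (* Outside [D] the guess set is empty, as is [guessed] over an empty [N]. *)
  exists vempty, vempty; split=> [x /vemptyP //|x /vemptyP //|h ha].
  apply: vext => x; split=> /vsepP [_].
    move=> [a' [s [m [aD' ha' _ _]]]].
    by case: aD; rewrite (vfuns_domain_inj ha ha').
  by case=> n /vemptyP.
have /vcountableP [nu nuP] := Lcountable aD.
pose N := vsep omega (fun n => exists s (m : nat), s ∈ L a /\ n = vnat (pickle (nu s, m))).
pose E := vsep (vprod (vprod omega omega) a) (fun p => exists s m k,
  [/\ s ∈ L a, m <= k & p = vpair (vpair (vnat (pickle (nu s, m))) (vnat k)) (q a s k)]).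
exists N, E; split=> [x /vsepP []//|x /vsepP []//|h ha].
apply: vext => x; split=> /vsepP [xr xP]; apply/vsepP; split=> //.
- case: xP => a' [s [m [aD' ha' sL xP]]].
  rewrite -(vfuns_domain_inj ha ha') in sL xP.
  exists (vnat (pickle (nu s, m))).
    by apply/vsepP; split; [exact: vnat_omega|exists s, m].
  move=> k b /vsepP [_ [s' [m' [k' [sL' mk]]]]].
  move=> /vpair_inj [/vpair_inj [/vnat_inj e ->] ->].
  have [es em] := pcan_inj (@pickleK _) e; subst m'.
  rewrite -(nuP _ _ sL sL' es).
  exists (app x (vnat k')); first exact: (app_vfuns xr (vnat_omega k')).1.
  by rewrite xP //; exact: (app_vfuns ha (qa k' aD sL)).1.
- case: xP => _ /vsepP [_ [s [m [sL ->]]]] xP.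
  exists a, s, m; split=> // k mk.
  have [|i xi hi] := xP (vnat k) (q a s k).
    apply/vsepP; split; last by exists s, m, k.
    apply/vpair_prodP; split; last exact: qa.
    by apply/vpair_prodP; split; exact: vnat_omega.
  by rewrite (app_vfuns_eq xr xi) (app_vfuns_eq ha hi).
Qed.

Definition guess_map : V :=
  vgraph guess_set (vunion (vimage (fun a => vfuns a a) omega1)).

Lemma vfuns_sub_union a : a ∈ omega1 ->
  vfuns a a ⊆ vunion (vimage (fun a => vfuns a a) omega1).
Proof.
move=> aw h hf; apply/vunionP; exists (vfuns a a); split=> //.
by apply/vimageP; exists a.
Qed.

Lemma guess_map_L_reals a : least_uncountable omega1 -> a ∈ omega1 ->
  L_reals_adj omega1 (restrict guess_map (vfuns a a)).
Proof.
move=> [o1 _ c1] aw M Minner ML _.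
(* Each real lies in [L_reals], an intersection of classes containing the reals. *)
have Mr r : r ∈ reals -> M r by move=> rr; apply: ML => M' _; apply.
have [N [E [Nw Ea gE]]] := guess_set_guessed aw.
rewrite /guess_map restrict_vgraph; last exact: vfuns_sub_union.
rewrite (_ : vgraph _ _ = vgraph (fun h => vsep reals (guessed N E h)) (vfuns a a)).
  by apply: M_guessed => //; [exact: ordinal_mem aw|exact: c1].
apply: vext => p; split=> /vgraph_memP [h [hf ->]]; apply/vgraphP; split=> //.
- exact: gE.
- by symmetry; exact: gE.
Qed.

End Guessing.

(** * The colouring *)

(** Induction on the size [n]: at most one index [k0] is sent to the last value, and a bound beyond
    it leaves only the smaller values. *)
Lemma vfinite_bounded (l : nat -> V) A : injective l -> vfinite A ->
  exists m, forall k, m <= k -> l k ∉ A.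
Proof.
move=> linj [_ /omegaP [n ->] [f [[ff finj] _]]].
suff [m mP] : exists m, forall k, l k ∈ A -> app f (l k) ∈ vnat n -> k < m.
  exists m => k mk kA; have := mP k kA (app_vfuns ff kA).2.
  by rewrite ltnNge mk.
elim: n {ff} => [|n [m IH]]; first by exists 0 => k _ /vemptyP.
have [[k0 [k0A e0]]|no] := pselect (exists k, l k ∈ A /\ app f (l k) = vnat n).
- exists (maxn m k0.+1) => k kA /vsuccP [/(IH k kA) h|e]; rewrite leq_max.
    by rewrite h.
  suff -> : k = k0 by rewrite leqnn orbT.
  by apply/linj/finj => //; rewrite e e0.
- exists m => k kA /vsuccP [/(IH k kA) //|e].
  by case: no; exists k.
Qed.

(** With an injective enumeration of each ladder, a finite set of exceptional points becomes a bound
    on the indices, by [vfinite_bounded]. *)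
Lemma ladder_enum C : ladder_system C -> exists lad : V -> nat -> V,
  forall a, a ∈ Lim1 -> [/\ injective (lad a), forall k, lad a k ∈ app C a,
    forall x, x ∈ app C a -> exists k, x = lad a k & app C a ⊆ a].
Proof.
move=> [_ CP].
have /choice [lad ladP] : forall a, exists l : nat -> V, a ∈ Lim1 ->
    [/\ injective l, forall k, l k ∈ app C a,
      forall x, x ∈ app C a -> exists k, x = l k & app C a ⊆ a].
  move=> a; have [/CP [[Ca _] [h [[hf hinj] hsurj] _]]|] := pselect (a ∈ Lim1).
    exists (fun k => app h (vnat k)) => _; split=> //.
    - by move=> k k' /hinj e; apply/vnat_inj/e; exact: vnat_omega.
    - by move=> k; exact: (app_vfuns hf (vnat_omega k)).2.
    - by move=> x /hsurj [_ /omegaP [k ->] <-]; exists k.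
  by exists (fun=> vempty).
by exists lad.
Qed.

Theorem mainTheorem2 :
  diamond_non_meager ->
  forall T R C : V, aleph1_tree T R -> ladder_system C ->
  exists f : V, two_colouring C f /\
    ~ exists phi : V, uniformization T R C f phi.
Proof.
move=> diamond T R C alT ladC.
have [[treeT o1 l1 _] lc] := alT.
have hT s : s ∈ T -> height T R s ∈ omega1 by exact: height_omega1.
have [lu|nlu] := pselect (exists a, least_uncountable a); last first.
  (* Without an uncountable ordinal [omega1] is the junk value [vempty]. *)
  have w0 x : x ∉ omega1.
    rewrite /omega1 /the; case: pselect => // _; exact: vemptyP.
  exists vempty; split.
    by split; [split=> [p /vemptyP //|x]|move=> a]; move=> /vsepP [/w0].
  move=> [phi [S [[ST /vnonempty [s sS] _ _] _ _]]].
  exact: w0 (hT _ (ST _ sS)).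
have {}lu : least_uncountable omega1 := theP lu.
have [B [B1 Bblock]] := exists_blocks lu.
have [c [cP cinj]] := exists_code alT Bblock.
have [lad ladP] := ladder_enum ladC.
pose D := closed_limits B.
have DP a : a ∈ D -> a ∈ omega1 /\ a ∈ Lim1.
  by move=> /closed_limitsP [aw la _]; split=> //; apply/vsepP.
have cD a t : a ∈ D -> t ∈ T -> height T R t ∈ a -> c t ∈ a.
  by move=> aD tT ta; have [n ->] := cP _ tT; exact: closed_limits_block.
pose q a s k := c (node_restrict T R s (lad a k)).
have restrictP a s k : a ∈ D -> s ∈ T -> height T R s = a ->
    node_restrict T R s (lad a k) ∈ predecessors T R s /\
    height T R (node_restrict T R s (lad a k)) = lad a k /\ lad a k ∈ a.
  move=> /DP [_ /ladP [_ lC _ Ca]] sT sa.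
  have la : lad a k ∈ a by exact/Ca/lC.
  by have [] := @node_restrictP T R treeT s (lad a k) sT; rewrite ?sa.
have qa a s k : a ∈ D -> s ∈ level T R a -> q a s k ∈ a.
  move=> aD /vsepP [sT sa]; have [/predecessors_sub nT [e la]] := restrictP _ _ k aD sT sa.
  by apply: cD; rewrite ?e.
have Lc a : a ∈ D -> vcountable (level T R a) by move=> /DP [aw _]; exact: lc.
pose F := guess_map D (level T R) q.
have [g g1 gP] : exists2 g, g ∈ vfuns omega1 reals &
    forall f, f ∈ vfuns omega1 omega1 -> stationary (vsep omega1 (fun a =>
      restrict f a ∈ vfuns a a /\ app g a ∉ app F (restrict f a))).
  (* The set of ordinals is [omega1] itself, with the identity as bijection. *)
  apply: (diamond omega1).
  - by move=> a; exact: ordinal_mem.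
  - exists (vgraph id omega1); split; last by move=> y yw; exists y; rewrite ?app_vgraph.
    split; first by apply: vgraph_vfuns.
    by move=> x y xw yw; rewrite !app_vgraph.
  - by apply: vgraph_vfuns => h _; exact: guess_set_meager.
  - by move=> a aw; exact: guess_map_L_reals.
pose col a := vsup (fun k => vpair (lad a k) (app (app g a) (vnat k))).
have colP a : a ∈ Lim1 -> col a ∈ vfuns (app C a) two.
  move=> aL; have [linj lC lsurj _] := ladP _ aL.
  have aw : a ∈ omega1 by case/vsepP: aL.
  have ga := (app_vfuns g1 aw).2.
  apply/vfunsP; split.
    move=> _ /vsupP [k ->]; exists (lad a k), (app (app g a) (vnat k)).
    by split=> //; exact: (app_vfuns ga (vnat_omega k)).2.
  move=> x /lsurj [k ->]; exists (app (app g a) (vnat k)).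
  split; first by apply/vsupP; exists k.
  by move=> y /vsupP [k' /vpair_inj[/linj <- ->]].
exists (vgraph col Lim1); split.
  split; first exact: vgraph_function.
  by move=> a aL; rewrite app_vgraph //; exact: colP.
move=> [phi [S [[ST /vnonempty [s0 s0S] Sdown Sup] _ unif]]].
(* The code of [phi]: [val x] is 1 if the node of [S] coded by [x] has value 1, and 0 in all other
   cases, in particular off the codes. *)
pose val x := if pselect (exists t, [/\ t ∈ S, c t = x & app phi t = vnat 1])
  then vnat 1 else vnat 0.
have n1 n : vnat n ∈ omega1.
  apply: omega1_intro => //; first exact: ordinal_vnat.
  by apply: vcountable_range; exists vnat => x /vnat_memP [m _ ->]; exists m.
(* [phi] may take values outside [two]; [val] recovers it where it is 0 or 1, which suffices at the
   nodes where it agrees with the colouring. *)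
have valP t : t ∈ S -> app phi t ∈ two -> val (c t) = app phi t.
  move=> tS /twoP p2; rewrite /val; case: pselect => [ex|no] /=.
  - by case: ex => u [uS ec eu]; rewrite -(cinj u t (ST _ uS) (ST _ tS) ec).
  - by case: p2 => // p1; case: no; exists t.
have fv : vgraph val omega1 ∈ vfuns omega1 omega1.
  by apply: vgraph_vfuns => x _; rewrite /val; case: pselect => h; exact: n1.
have [_ /(_ D (club_closed_limits lu B1 Bblock)) [a aD]] := gP _ fv.
move=> /vsepP [aw]; rewrite restrict_vgraph; last first.
  by move=> x; exact: ordinal_trans.
move=> [fa]; rewrite app_vgraph; last exact: vfuns_sub_union fa.
(* It remains to put [g a] into the guess set of the coded [phi], against the choice of [a]. *)
apply; have [_ aL] := DP _ aD; have [linj lC lsurj Ca] := ladP _ aL.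
have ga := (app_vfuns g1 aw).2.
(* Extend a node of [S] to height at least [a] and cut it back to height [a]. *)
have [s sS sa] : exists2 s, s ∈ S & height T R s = a.
  have [t [tS _ [e|h]]] := Sup _ _ s0S aw; first by exists t.
  have [/predecessorsP [nT [nt _]] e] := node_restrictP treeT (ST _ tS) h.
  by exists (node_restrict T R t a) => //; exact: Sdown nt.
have sT := ST _ sS.
have [m mP] := vfinite_bounded linj (unif _ _ sS aL sa).
apply/vsepP; split=> //; exists a, s, m; split=> //; first by apply/vsepP.
move=> k mk; have [/predecessorsP [nT [ns _]] [e la]] := restrictP _ _ k aD sT sa.
have nS := Sdown _ _ sS nT ns.
have ephi : app phi (node_restrict T R s (lad a k)) = app (app g a) (vnat k).
  apply: contrapT => ne; apply: (mP k mk); apply/vsepP; split=> //.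
  rewrite app_vgraph // (app_vfuns_eq (colP _ aL) (y := app (app g a) (vnat k))) //.
  by apply/vsupP; exists k.
rewrite app_vgraph; last by apply: qa => //; apply/vsepP.
rewrite valP ?ephi //.
exact: (app_vfuns ga (vnat_omega k)).2.
Qed.
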